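(* Let $G=(V,E)$ be a connected acyclic graph with vertex set $V=\{1,2,\ldots,n\}$, and let $\widetilde{E}=\{(i,j):\{i,j\}\in E,\ i<j\}$. Let $\mathbf{Q}:\widetilde{E}\to\mathcal{B}(\mathcal{H})$ be a function taking each $(i,j)\in\widetilde{E}$ to a contraction $\mathbf{Q}(i,j)$. Let $T_1,\ldots,T_n$ be contractions on $\mathcal{H}$ such that $(T_1,\ldots,T_n)$ is $(G,\mathbf{Q},L)$-commuting (respectively, $(G,\mathbf{Q},M)$-commuting). Then there is a Hilbert space $\mathcal{K}$ containing $\mathcal{H}$, a function $\overline{\mathbf{Q}}:\widetilde{E}\to\mathcal{B}(\mathcal{K})$ such that for each $(i,j)\in\widetilde{E}$, $\overline{\mathbf{Q}}(i,j)$ is an isometric lift of $\mathbf{Q}(i,j)$, and isometric lifts $V_1,\ldots,V_n\in\mathcal{B}(\mathcal{K})$ of $T_1,\ldots,T_n$ respectively, such that $(V_1,\ldots,V_n)$ is $(G,\overline{\mathbf{Q}},L)$-commuting (respectively, $(G,\overline{\mathbf{Q}},M)$-commuting). Moreover, if for any $(i,j)\in\widetilde{E}$, $\mathbf{Q}(i,j)$ is a unitary, then we can choose $\overline{\mathbf{Q}}(i,j)=\mathbf{Q}(i,j)\oplus I$ on $\mathcal{K}=\mathcal{H}\oplus(\mathcal{K}\ominus\mathcal{H})$.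
   Context: All Hilbert spaces are complex; $\mathcal{B}(\mathcal{H})$ is the algebra of bounded linear operators on $\mathcal{H}$; containment of Hilbert spaces means containment as a closed linear subspace; a contraction is an operator of norm at most one. Graphs are finite and simple (edges are unordered pairs of distinct vertices); acyclic means containing no cycle as a subgraph. An operator $B\in\mathcal{B}(\mathcal{K})$ is a lift of $A\in\mathcal{B}(\mathcal{H})$, $\mathcal{H}\subseteq\mathcal{K}$, if $\mathcal{H}$ is invariant under $B^*$ and $B^*|_{\mathcal{H}}=A^*$; it is an isometric lift if in addition $B$ is an isometry. For a graph $G=(V,E)$ with $V=\{1,\ldots,n\}$, $\widetilde{E}=\{(i,j):\{i,j\}\in E,\ i<j\}$, and a function $\mathbf{Q}$ from $\widetilde{E}$ to the contractions in $\mathcal{B}(\mathcal{H})$, a tuple $(T_1,\ldots,T_n)$ of bounded operators on $\mathcal{H}$ is called $(G,\mathbf{Q},L)$-commuting if $T_iT_j=\mathbf{Q}(i,j)T_jT_i$ for all $(i,j)\in\widetilde{E}$, and $(G,\mathbf{Q},M)$-commuting if $T_iT_j=T_j\mathbf{Q}(i,j)T_i$ for all $(i,j)\in\widetilde{E}$. *)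

(* Defs.v *)
From HB Require Import structures.
From mathcomp Require Import all_boot all_order all_algebra.
From mathcomp Require Import complex.
From mathcomp Require Import all_classical all_reals.
From mathcomp Require Import ereal topology normedtype.

Set Implicit Arguments.
Unset Strict Implicit.
Unset Printing Implicit Defensive.
Import Order.TTheory GRing.Theory Num.Theory.
Import numFieldNormedType.Exports.
Local Open Scope classical_set_scope.
Local Open Scope complex_scope.
Local Open Scope ring_scope.

(* Complex Hilbert spaces, over the complex numbers R[i].  The inner product is
   linear in its first argument, conjugate-linear in the second, Hermitian and
   positive definite (this is {dot V for Num.conj}), and it induces the norm. *)
HB.mixin Record NormedModule_isHilbert (R : realType) V
    & CompleteNormedModule R[i] V := {
  inner : {dot V for (@Num.conj R[i])};
  inner_norm : forall x : V, inner x x = `|x| ^+ 2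
}.

#[short(type="hilbertType")]
HB.structure Definition Hilbert (R : realType) :=
  {V of CompleteNormedModule R[i] V & NormedModule_isHilbert R V}.

Arguments inner {R s}.

Record bounded_op (R : realType) (H : hilbertType R) := BoundedOp {
  op_linear :> {linear H -> H};
  op_bounded : exists M : R[i], forall x : H, `|op_linear x| <= M * `|x|
}.

Section Operators.
Variables (R : realType) (H : hilbertType R).
Implicit Types A : bounded_op H.

(* The norm of H takes its values among the nonnegative reals of R[i], hence
   the real part. *)
Definition opnorm A : \bar R :=
  ereal_sup [set (complex.Re `|A x|)%:E | x in [set x : H | `|x| <= 1]].

Definition op_contraction A : Prop := (opnorm A <= 1)%E.

Definition op_isometry A : Prop := forall x : H, `|A x| = `|x|.

(* By the Riesz representation theorem there is exactly one z with the stated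
   property, so that the default value 0 of xget is never used. *)
Definition op_adjoint A (y : H) : H :=
  xget 0 [set z : H | forall x : H, inner (A x) y = inner x z].

Definition op_unitary A : Prop :=
  op_adjoint A \o A =1 id /\ A \o op_adjoint A =1 id.

End Operators.

(* "K contains H as a closed linear subspace" is rendered by a linear map
   J : H -> K preserving inner products, which identifies H with J(H); the
   range of J is closed because H is complete. *)
Definition hilbert_embedding (R : realType) (H K : hilbertType R)
    (J : {linear H -> K}) : Prop :=
  forall x y : H, inner (J x) (J y) = inner x y.

Section Lifts.
Variables (R : realType) (H K : hilbertType R) (J : {linear H -> K}).
Implicit Types (A : bounded_op H) (B : bounded_op K).

(* The equation says both that B^* maps J(H) into itself, and that its
   restriction to J(H) is A^*. *)
Definition op_lift A B : Prop :=
  forall h : H, op_adjoint B (J h) = J (op_adjoint A h).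

Definition op_isometric_lift A B : Prop := op_lift A B /\ op_isometry B.

(* B is A (+) I with respect to K = J(H) (+) J(H)^perp. *)
Definition dsum_id A B : Prop :=
  (forall h : H, B (J h) = J (A h)) /\
  (forall k : K, (forall h : H, inner k (J h) = 0) -> B k = k).

End Lifts.

(* Finite simple graphs on the vertices 0, ..., n-1. *)
Record sgraph (n : nat) := SGraph {
  adj :> rel 'I_n;
  adj_sym : symmetric adj;
  adj_irr : irreflexive adj
}.

Section Graphs.
Variables (n : nat) (G : sgraph n).

Definition connected_graph : Prop :=
  (0 < n)%N /\ forall x y : 'I_n, connect G x y.

(* A cycle has at least three vertices, which are pairwise distinct. *)
Definition acyclic : Prop :=
  forall c : seq 'I_n, (2 < size c)%N -> ~ ucycle G c.

Definition oedge := {p : 'I_n * 'I_n | G p.1 p.2 && (p.1 < p.2)%N}.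

Variables (R : realType) (H : hilbertType R).

Definition GQL_commuting
    (Q : oedge -> bounded_op H) (T : 'I_n -> bounded_op H) : Prop :=
  forall p : oedge, let i := (val p).1 in let j := (val p).2 in
    T i \o T j =1 Q p \o T j \o T i.

Definition GQM_commuting
    (Q : oedge -> bounded_op H) (T : 'I_n -> bounded_op H) : Prop :=
  forall p : oedge, let i := (val p).1 in let j := (val p).2 in
    T i \o T j =1 T j \o Q p \o T i.

End Graphs.

(* Main.v *)
Require Import Defs.
From HB Require Import structures.
From mathcomp Require Import all_boot all_order all_algebra.
From mathcomp Require Import complex.
From mathcomp Require Import all_classical all_reals.
From mathcomp Require Import ereal topology normedtype sequences.
From mathcomp Require Import ring lra zify.

Import Order.TTheory GRing.Theory Num.Theory.
Import numFieldNormedType.Exports.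
Set Implicit Arguments.
Unset Strict Implicit.
Unset Printing Implicit Defensive.
Local Open Scope classical_set_scope.
Local Open Scope ring_scope.

(** All lifts are built on one Hilbert space, the space E of square-summable
    sequences in H, in which H is the coordinate of index 0.  Write P for the
    projection of E onto H.  An isometry V of E is a lift of T exactly when
    P V = T P.  Since E is the sum of its even and its odd coordinates, each
    of which forms a copy of E, the space K + K is again E.

    A contraction T has a defect operator D with |D h|^2 = |h|^2 - |T h|^2
    ([defect_exists]), and x |-> T P x + D P x + S (x - P x) is an isometric
    lift of T as soon as S is an isometry, with range orthogonal to H and to
    the range of D ([schaffer_lift]).

    The unitaries of the proof are all reflections.  Let e be a family of
    vectors, V a bounded operator, and suppose that the orthogonal complement
    of the orbit of e under V is invariant under V.  The adjoint of V leaves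
    this complement invariant anyway, so the reflection in it commutes with V
    ([reflection]).  This has two applications.

    - Let X and Y be isometric lifts of one contraction A that agree on the
      complement of H, and for which X - A and Y - A send H into orthogonal
      subspaces.  Reflecting in the complement of the orbit of (X - Y) H gives
      a unitary C with C X = Y C that fixes H ([intertwine]).  Now let
      A = T1 T2 and choose lifts V1, V2, Qb of T1, T2, Q whose defect parts use
      disjoint sets of coordinates and for which Qb acts as the identity on all
      coordinates that V1 and V2 reach.  Then X = V1 V2 and Y = Qb V2 V1, or
      Y = V2 Qb V1, satisfy the hypotheses, and C V1, V2 C satisfy the twisted
      commutation relation ([pair_lift]): this is Ando's theorem with a twist.

    - Let V1 and V2 be any isometric lifts of one contraction, on two copies
      of E.  Reflecting in the complement of the orbit of the vectors (h, -h)
      gives a unitary that commutes with the direct sum of V1 and V2 and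
      exchanges the two copies of H ([amalgam]).

    A connected acyclic graph grows from one vertex by adding vertices y that
    have exactly one neighbour j among the vertices already present.  When y
    is added, the lift of T_j found so far and the lift of T_j in a lifted pair
    for the edge {j, y} are different, but by [amalgam] their direct sum can
    be seen from either copy of H.  The old lifts get the new lift of T_j as
    second summand, the old twists get the identity, and the lifts attached to
    y and to the new edge are transported by the reflection
    ([lifted_on_grow]).

    A twist that is an isometry, in particular a unitary one, is lifted by
    Q + I; every step above preserves this form. *)

(** * Inner products and squared norms *)

Section DotProduct.
Variables (R : realType) (V : lmodType R[i]).
Variable d : {dot V for @Num.conj R[i]}.
Implicit Types (x y z : V) (a : R[i]).

Lemma innerDl x y z : d (x + y) z = d x z + d y z.
Proof. exact: linearDl. Qed.
Lemma innerDr x y z : d z (x + y) = d z x + d z y.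
Proof. exact: linearDr. Qed.
Lemma innerNl x z : d (- x) z = - d x z.
Proof. exact: linearNl. Qed.
Lemma innerNr x z : d z (- x) = - d z x.
Proof. exact: linearNr. Qed.
Lemma innerBl x y z : d (x - y) z = d x z - d y z.
Proof. exact: linearBl. Qed.
Lemma innerBr x y z : d z (x - y) = d z x - d z y.
Proof. exact: linearBr. Qed.
Lemma inner0l z : d 0 z = 0.
Proof. exact: linear0l. Qed.
Lemma inner0r z : d z 0 = 0.
Proof. exact: linear0r. Qed.
Lemma innerZl a x z : d (a *: x) z = a * d x z.
Proof. exact: linearZl_LR. Qed.
Lemma innerZr a x z : d z (a *: x) = Num.conj a * d z x.
Proof. exact: linearZr_LR. Qed.
Lemma innerC x y : d x y = Num.conj (d y x).
Proof. by rewrite [LHS]hermC expr0 mul1r. Qed.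

Lemma inner_eq0C x y : d x y = 0 -> d y x = 0.
Proof. by move=> xy0; rewrite innerC xy0 rmorph0. Qed.

(** Norms take values in R[i]; working with the real squared norm instead
    gives access to the total order of R. *)
Definition sqnorm_of x : R := complex.Re (d x x).

Lemma sqnE x : d x x = (sqnorm_of x)%:C%C.
Proof. by rewrite /sqnorm_of RRe_real // ger0_real. Qed.

Lemma sqn_ge0 x : 0 <= sqnorm_of x.
Proof. by rewrite -ler0c -sqnE dnorm_ge0. Qed.

Lemma sqn_eq0 x : sqnorm_of x = 0 -> x = 0.
Proof. by move=> x0; apply/eqP; rewrite -(dnorm_eq0 d) sqnE x0. Qed.

Lemma sqn0 : sqnorm_of 0 = 0.
Proof. by rewrite /sqnorm_of inner0l. Qed.

Lemma sqnD x y : sqnorm_of (x + y) = sqnorm_of x + sqnorm_of y + 2 * complex.Re (d x y).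
Proof.
rewrite /sqnorm_of innerDl !innerDr (innerC y x) !raddfD /=.
by case: (d x y) => a b /=; ring.
Qed.

Lemma sqnN x : sqnorm_of (- x) = sqnorm_of x.
Proof. by rewrite /sqnorm_of innerNl innerNr opprK. Qed.

Lemma sqnB x y : sqnorm_of (x - y) = sqnorm_of x + sqnorm_of y - 2 * complex.Re (d x y).
Proof. by rewrite sqnD sqnN innerNr raddfN mulrN. Qed.

Lemma sqnZ (t : R) x : sqnorm_of (t%:C%C *: x) = t ^+ 2 * sqnorm_of x.
Proof.
rewrite /sqnorm_of innerZl innerZr.
by case: (d x x) => a b /=; rewrite !(mul0r, mulr0, oppr0, subr0, addr0); ring.
Qed.

Lemma Re_innerZ (t : R) x y :
  complex.Re (d x (t%:C%C *: y)) = t * complex.Re (d x y).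
Proof.
rewrite innerZr; case: (d x y) => a b /=.
by rewrite oppr0 mul0r subr0.
Qed.

Lemma Re_innerZi x y :
  complex.Re (d ('i%C *: x) y) = - complex.Im (d x y).
Proof. by rewrite innerZl mulrC ReiNIm. Qed.

Lemma discriminant_le (a r s : R) : 0 <= s ->
  (forall t, 0 <= a + 2 * t * r + t ^+ 2 * s) -> r ^+ 2 <= a * s.
Proof.
move=> s0 h; have [s1|sn] := eqVneq s 0.
  have [->|rn] := eqVneq r 0; first by rewrite s1 mulr0 expr0n.
  have := h (- (a + 1) / (2 * r)).
  have -> : a + 2 * (- (a + 1) / (2 * r)) * r + (- (a + 1) / (2 * r)) ^+ 2 * s
    = -1 by rewrite s1; field.
  lra.
have sp : 0 < s by rewrite lt_def sn.
have := h (- r / s).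
have -> : a + 2 * (- r / s) * r + (- r / s) ^+ 2 * s = (a * s - r ^+ 2) / s.
  by field.
by rewrite pmulr_lge0 ?invr_gt0 // subr_ge0.
Qed.

Lemma cauchy_schwarz_Re x y :
  complex.Re (d x y) ^+ 2 <= sqnorm_of x * sqnorm_of y.
Proof.
apply: discriminant_le (sqn_ge0 _) _ => t.
have := sqn_ge0 (x + t%:C%C *: y).
by rewrite sqnD sqnZ Re_innerZ mulrA addrAC.
Qed.

Lemma sqnD_le2 x y : sqnorm_of (x + y) <= 2 * sqnorm_of x + 2 * sqnorm_of y.
Proof. have := sqn_ge0 (x - y); rewrite sqnB sqnD; lra. Qed.

(** The triangle inequality, needed before the norm of the sequence space
    exists. *)
Lemma sqrt_sqnD x y :
  Num.sqrt (sqnorm_of (x + y)) <= Num.sqrt (sqnorm_of x) + Num.sqrt (sqnorm_of y).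
Proof.
rewrite -[leRHS]ger0_norm ?addr_ge0 ?sqrtr_ge0 // -sqrtr_sqr ler_sqrt ?sqr_ge0 //.
rewrite sqrrD !sqr_sqrtr ?sqn_ge0 // sqnD [leRHS]addrAC lerD2l.
rewrite -[leRHS]mulr_natl ler_pM2l //.
apply: le_trans (ler_norm _) _; rewrite -sqrtrM ?sqn_ge0 // -sqrtr_sqr.
by rewrite ler_wsqrtr // cauchy_schwarz_Re.
Qed.

End DotProduct.

Arguments innerC {R V d} x y.
Arguments sqn_ge0 {R V d} x.
Arguments cauchy_schwarz_Re {R V d} x y.
Arguments sqnD_le2 {R V d} x y.

Notation sqn := (sqnorm_of inner).
Arguments inner : simpl never.

Section HilbertNorm.
Variables (R : realType) (H : hilbertType R).
Implicit Types (x y z : H).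

Lemma norm_sqn x : `|x| = (Num.sqrt (sqn x))%:C%C.
Proof.
apply/eqP; rewrite -(@eqrXn2 _ 2) ?normr_ge0 ?ler0c ?sqrtr_ge0 //.
by rewrite -inner_norm sqnE -rmorphXn /= sqr_sqrtr ?sqn_ge0.
Qed.

Lemma norm_lt_sqn x (e : R) : 0 < e -> (`|x| < e%:C%C) = (sqn x < e ^+ 2).
Proof.
move=> e0; rewrite norm_sqn ltcR -{1}(ger0_norm (ltW e0)) -sqrtr_sqr.
by rewrite ltr_sqrt // exprn_gt0.
Qed.

Lemma gt0_realC (e : R[i]) : 0 < e -> exists2 r : R, 0 < r & e = r%:C%C.
Proof.
case: e => a b; rewrite ltcE /= => /andP[/eqP -> a0].
by exists a.
Qed.

Lemma inner_inj (x y : H) : (forall z, inner z x = inner z y) -> x = y.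
Proof.
move=> h; apply/eqP; rewrite -subr_eq0; apply/eqP/(@sqn_eq0 _ _ inner).
by rewrite /sqnorm_of innerBr h subrr.
Qed.

(** Completeness of H, restated for real squared norms. *)
Lemma sqn_cauchy_converges (u : nat -> H) :
  (forall e : R, 0 < e -> exists N, forall m n, (N <= m)%N -> (N <= n)%N ->
     sqn (u m - u n) < e) ->
  exists z, forall e : R, 0 < e -> exists N, forall n, (N <= n)%N ->
     sqn (u n - z) < e.
Proof.
move=> hu.
have uc : cvg (u @ \oo).
  apply: cauchy_cvg; apply: cauchy_exP => _ /gt0_realC[e e0 ->].
  have [N hN] := hu (e ^+ 2) (exprn_gt0 _ e0).
  exists (u N); exists N => // n /= Nn; rewrite -ball_normE /=.
  by rewrite norm_lt_sqn // hN.
exists (lim (u @ \oo)) => e e0.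
have se0 : 0 < Num.sqrt e by rewrite sqrtr_gt0.
move/cvgrPdist_lt: uc => /(_ (Num.sqrt e)%:C%C); rewrite ltcR => /(_ se0).
case=> N _ hN; exists N => n /hN /=.
by rewrite distrC norm_lt_sqn // sqr_sqrtr ?ltW.
Qed.

End HilbertNorm.

(** * Orthogonal projections, adjoints and reflections *)

Section Riesz.
Variables (R : realType) (K : hilbertType R).
Implicit Types (x y z : K) (M : K -> Prop).

Definition closed_submod M : Prop :=
  [/\ M 0, forall x y, M x -> M y -> M (x + y),
      forall (a : R[i]) x, M x -> M (a *: x) &
      forall x, (forall e : R, 0 < e -> exists2 y, M y & sqn (x - y) < e) ->
        M x].

Fact le_add_of_sqr_le_mul (C s r : R) :
  0 <= C -> 0 <= s -> r ^+ 2 <= C * s -> 2 * r <= s + C.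
Proof.
move=> C0 s0 h; rewrite leNgt; apply/negP => h2.
have : (s + C) ^+ 2 < (2 * r) ^+ 2 by rewrite ltr_pXn2r ?nnegrE //; lra.
have := sqr_ge0 (s - C); nra.
Qed.

Fact midpoint_ineq (m a c s s' r : R) :
  m <= 4^-1 * (s + s' + 2 * r) - 2 * (2^-1 * (a + c)) ->
  s + s' - 2 * r <= 2 * (s - 2 * a - m) + 2 * (s' - 2 * c - m).
Proof. lra. Qed.

(** Minimize |x|^2 - 2 Re (phi x) over M.  By the parallelogram identity a
    minimizing sequence is Cauchy, and the first-order condition at its limit z
    is Re (phi x) = Re <x, z>.  With M the whole space this is the Riesz
    representation theorem, with phi = <., y> it is the orthogonal projection
    of y onto M. *)
Lemma riesz_on_subspace M (phi : K -> R[i]) (C : R) : 0 <= C -> closed_submod M ->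
  (forall x y, phi (x + y) = phi x + phi y) ->
  (forall (a : R[i]) x, phi (a *: x) = a * phi x) ->
  (forall x, complex.Re (phi x) ^+ 2 <= C * sqn x) ->
  exists2 z, M z & forall x, M x -> phi x = inner x z.
Proof.
move=> C0 [M0 MD MZ Mcl] phiD phiZ phiC.
pose F x := sqn x - 2 * complex.Re (phi x).
have FD x y (t : R) : F (x + t%:C%C *: y)
   = F x + 2 * t * (complex.Re (inner x y) - complex.Re (phi y)) + t ^+ 2 * sqn y.
  rewrite /F sqnD sqnZ Re_innerZ phiD phiZ raddfD /=.
  by case: (phi y) => a b /=; ring.
have Flb x : - C <= F x.
  rewrite /F lerNl opprB lerBlDr addrC.
  exact: le_add_of_sqr_le_mul (sqn_ge0 x) (phiC x).
pose S := [set F x | x in M].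
have Sinf : has_inf S.
  split; first by exists (F 0); exists 0.
  by exists (- C) => _ [x _ <-]; exact: Flb.
have [m mF madh] : exists2 m : R, forall x, M x -> m <= F x &
    forall e, 0 < e -> exists2 x, M x & F x < m + e.
  exists (inf S) => [x Mx|e e0]; first by apply: ge_inf; [case: Sinf|exists x].
  by have [_ [x Mx <-] Fx] := inf_adherent e0 Sinf; exists x.
have /choice[u uP] : forall n, exists x, M x /\ F x < m + n.+1%:R^-1.
  move=> n.
  have n0 : 0 < n.+1%:R^-1 :> R by rewrite invr_gt0 ltr0n.
  by have [x Mx Fx] := madh _ n0; exists x.
have par x y : M x -> M y -> sqn (x - y) <= 2 * (F x - m) + 2 * (F y - m).
  move=> Mx My.
  have := mF ((2^-1)%:C%C *: (x + y)) (MZ _ _ (MD _ _ Mx My)).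
  rewrite /F sqnZ phiZ phiD sqnD sqnB.
  have -> : (2^-1 : R) ^+ 2 = 4^-1 by field.
  case: (phi x) (phi y) => a b [c d] /=; rewrite mul0r subr0.
  exact: midpoint_ineq.
have inv_small (e : R) : 0 < e -> exists N, forall n, (N <= n)%N -> n.+1%:R^-1 < e.
  move=> e0; exists (Num.bound e^-1) => n Nn.
  rewrite -[ltRHS]invrK ltf_pV2 ?posrE ?ltr0n ?invr_gt0 //.
  apply: lt_le_trans (archi_boundP _) _; first by rewrite invr_ge0 ltW.
  by rewrite ler_nat leqW.
have [z zP] : exists z, forall e : R, 0 < e -> exists N, forall n, (N <= n)%N ->
     sqn (u n - z) < e.
  apply: sqn_cauchy_converges => e e0.
  have [|N hN] := inv_small (e / 4); first by rewrite divr_gt0.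
  exists N => p q Np Nq; have [Mp Fp] := uP p; have [Mq Fq] := uP q.
  have := par _ _ Mp Mq; move: (hN _ Np) (hN _ Nq) Fp Fq.
  move: (p.+1%:R^-1) (q.+1%:R^-1) => dp dq; lra.
have Mz : M z.
  apply: Mcl => e /zP[N hN]; exists (u N); first by case: (uP N).
  by rewrite -sqnN opprB hN.
exists z => //.
have reP x : M x -> complex.Re (phi x) = complex.Re (inner x z).
  move=> Mx; apply/eqP; rewrite -subr_eq0 -normr_le0; apply/ler_addgt0Pl => e e0.
  rewrite addr0.
  pose d := (e / 2) ^+ 2 / (sqn x + 1).
  have sx1 : 0 < sqn x + 1 by rewrite ltr_pwDr ?sqn_ge0.
  have d0 : 0 < d by rewrite divr_gt0 ?exprn_gt0 // divr_gt0.
  have [N1 h1] := zP d d0; have [N2 h2] := inv_small d d0.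
  set n := maxn N1 N2.
  have [Mn Fn] := uP n.
  have {h1} zn := h1 n (leq_maxl _ _); have {h2} dn := h2 n (leq_maxr _ _).
  have sx0 := sqn_ge0 x.
  have dx : d * sqn x <= (e / 2) ^+ 2.
    rewrite /d mulrAC ler_pdivrMr // ler_pM2l ?exprn_gt0 ?divr_gt0 //; lra.
  (* near the minimum, x |-> F (u n + t x) - m is a quadratic function of t that
     is bounded below by -1/(n+1), which bounds its linear coefficient *)
  have A1 : `|complex.Re (inner (u n) x) - complex.Re (phi x)| <= e / 2.
    rewrite -(@ler_pXn2r _ 2) ?nnegrE ?divr_ge0 ?(ltW e0) ?normr_ge0 //.
    rewrite -normrX ger0_norm ?sqr_ge0 //; apply: le_trans dx.
    apply: discriminant_le => // t.
    have := mF (u n + t%:C%C *: x) (MD _ _ Mn (MZ _ _ Mx)).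
    rewrite FD; move: Fn dn; move: (n.+1%:R^-1) => dn; lra.
  have A2 : `|complex.Re (inner (u n - z) x)| <= e / 2.
    rewrite -(@ler_pXn2r _ 2) ?nnegrE ?divr_ge0 ?(ltW e0) ?normr_ge0 //.
    rewrite -normrX ger0_norm ?sqr_ge0 //; apply: le_trans dx.
    apply: le_trans (cauchy_schwarz_Re _ _) _.
    by rewrite ler_wpM2r // ltW.
  have : complex.Re (inner x z) = complex.Re (inner z x).
    by rewrite innerC; case: (inner z x).
  move=> ->; move: A2; rewrite innerBl raddfB /=.
  move: A1; rewrite !ler_norml; lra.
move=> x Mx; apply/eqP; rewrite eq_complex reP // eqxx /=.
(* the imaginary part of phi x is minus the real part of phi (i x) *)
have := reP _ (MZ 'i%C x Mx).
by rewrite phiZ mulrC ReiNIm Re_innerZi => /oppr_inj ->.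
Qed.

Lemma closed_submod_full : closed_submod (fun=> True).
Proof. by split. Qed.

End Riesz.

Lemma linear_bundle (R : nzRingType) (U V : lmodType R) (f : U -> V) :
  linear f -> exists g : {linear U -> V}, g =1 f.
Proof.
move=> lf; pose g := GRing.isLinear.Build R U V *:%R f lf.
by exists (HB.pack_for {linear U -> V} f g).
Qed.

Section Adjoint.
Variables (R : realType) (K L : hilbertType R).

Definition bounded_lin (V : K -> L) : Prop :=
  exists C : R, forall x, sqn (V x) <= C * sqn x.

Lemma adjoint_exists (V : {linear K -> L}) : bounded_lin V ->
  exists V' : {linear L -> K}, forall x y, inner (V x) y = inner x (V' y).
Proof.
move=> [C VC].
have /choice[f fP] : forall y : L, exists z : K, forall x : K, inner (V x) y = inner x z.
  move=> y.
  have [||x x'|a x|x|z _ zP] := @riesz_on_subspace R K (fun=> True)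
    (fun x => inner (V x) y) (`|C| * sqn y).
  - by rewrite mulr_ge0 ?sqn_ge0.
  - exact: closed_submod_full.
  - by rewrite linearD innerDl.
  - by rewrite linearZ innerZl.
  - apply: le_trans (cauchy_schwarz_Re _ _) _.
    rewrite [leRHS]mulrAC ler_wpM2r ?sqn_ge0 //; apply: le_trans (VC x) _.
    by rewrite ler_wpM2r ?sqn_ge0 ?ler_norm.
  by exists z => x; exact: zP.
have lf : linear f.
  move=> a x y; apply: inner_inj => z.
  by rewrite -fP !innerDr !innerZr !fP.
by have [g gE] := linear_bundle lf; exists g => x y; rewrite gE.
Qed.

End Adjoint.

Section Projection.
Variables (R : realType) (K : hilbertType R).
Implicit Types (x y z : K) (M : K -> Prop).

(** Orthogonal complements are closed because inner products are continuous. *)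
Lemma closed_submod_orth (I : Type) (d : I -> K) :
  closed_submod (fun y => forall i, inner y (d i) = 0).
Proof.
split=> [i|x y hx hy i|a x hx i|x h i].
- exact: inner0l.
- by rewrite innerDl hx hy addr0.
- by rewrite innerZl hx mulr0.
have re0 (w : K) : (forall y, (forall i, inner y (d i) = 0) -> inner y w = 0) ->
    complex.Re (inner x w) = 0.
  move=> hw; apply/eqP; rewrite -sqrf_eq0; apply/eqP/le_anti/andP; split; last exact: sqr_ge0.
  apply/ler_addgt0Pl => e e0; rewrite addr0.
  have w1 : 0 < sqn w + 1 by rewrite ltr_pwDr ?sqn_ge0.
  have [|y My xy] := h (e / (sqn w + 1)); first by rewrite divr_gt0.
  have -> : inner x w = inner (x - y) w by rewrite innerBl (hw y) // subr0.
  apply: le_trans (cauchy_schwarz_Re _ _) _.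
  apply: le_trans (ler_wpM2r (sqn_ge0 w) (ltW xy)) _.
  rewrite mulrAC ler_pdivrMr // ler_pM2l //; lra.
apply/eqP; rewrite eq_complex; apply/andP; split; apply/eqP.
  by apply: re0 => y; exact.
rewrite -[LHS]opprK -Re_innerZi raddf0 -[RHS]oppr0; congr (- _).
have -> : complex.Re (inner ('i%C *: x) (d i)) = - complex.Re (inner x ('i%C *: d i)).
  by rewrite innerZl innerZr; case: (inner x (d i)) => a b /=; ring.
by rewrite re0 ?oppr0 // => y hy; rewrite innerZr hy mulr0.
Qed.

Lemma projection_exists M : closed_submod M ->
  exists q : {linear K -> K},
    (forall x, M (q x)) /\ (forall x z, M z -> (forall y, M y -> inner (x - z) y = 0) -> q x = z)
    /\ (forall x y, M y -> inner (x - q x) y = 0).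
Proof.
move=> Mcl; have [M0 MD MZ _] := Mcl.
have /choice[f fP] : forall x, exists z, M z /\ forall y, M y -> inner (x - z) y = 0.
  move=> x; have [|y y'|a y|y|z Mz zP] := @riesz_on_subspace R K M
    (fun y => inner y x) (sqn x) _ Mcl.
  - exact: sqn_ge0.
  - exact: innerDl.
  - exact: innerZl.
  - by rewrite mulrC cauchy_schwarz_Re.
  exists z; split=> // y My; apply: inner_eq0C.
  by rewrite innerBr zP // subrr.
have uniq x z : M z -> (forall y, M y -> inner (x - z) y = 0) -> f x = z.
  move=> Mz zP; have [Mf fxP] := fP x.
  apply/eqP; rewrite -subr_eq0; apply/eqP/(@sqn_eq0 _ _ inner).
  have Md : M (f x - z) by rewrite -scaleN1r; apply: MD => //; apply: MZ.
  have -> : sqn (f x - z) = complex.Re (inner ((x - z) - (x - f x)) (f x - z)).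
    by rewrite opprB [x - z + _]addrC addrA subrK.
  by rewrite innerBl zP // fxP // subrr.
have lf : linear f.
  move=> a x y; apply: uniq.
    by apply: MD; [apply: MZ|]; case: (fP x) (fP y) => ? _ [].
  move=> w Mw; rewrite opprD addrACA -scalerBr innerDl innerZl.
  by rewrite (fP x).2 // (fP y).2 // mulr0 addr0.
have [q qE] := linear_bundle lf.
exists q; split=> [x|]; first by rewrite qE; exact: (fP x).1.
by split=> [x z|x y]; rewrite qE; [exact: uniq|exact: (fP x).2].
Qed.

(** The map rho is the reflection 2 q - 1, where q is the projection onto the
    orthogonal complement M of the orbit.  The adjoint of V maps M into M, since
    V maps the orbit into itself; together with the hypothesis that V maps M
    into M this makes V commute with q. *)
Lemma reflection (I : Type) (e : I -> K) (V : {linear K -> K}) :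
  bounded_lin V ->
  let orth y := forall p : I * nat, inner y (iter p.2 V (e p.1)) = 0 in
  (forall y, orth y -> orth (V y)) ->
  exists rho : {linear K -> K},
   [/\ forall x, rho (rho x) = x,
       forall x y, inner (rho x) y = inner x (rho y),
       forall i, rho (e i) = - e i,
       forall y, orth y -> rho y = y &
       forall x, rho (V x) = V (rho x)].
Proof.
move=> Vb orth orthV.
have [V' V'P] := adjoint_exists Vb.
have orthV' y : orth y -> orth (V' y).
  move=> oy [i n] /=; apply: inner_eq0C.
  by rewrite -V'P; apply: inner_eq0C; exact: (oy (i, n.+1)).
have [q [qM [quniq qo]]] := projection_exists
  (closed_submod_orth (fun p : I * nat => iter p.2 V (e p.1))).
have qid y : orth y -> q y = y.
  by move=> oy; apply: quniq => // z _; rewrite subrr inner0l.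
have qsa x y : inner (q x) y = inner x (q y).
  have -> : inner (q x) y = inner (q x) (q y).
    by rewrite -[y in LHS](subrK (q y)) innerDr (inner_eq0C (qo _ _ (qM x))) add0r.
  by rewrite -{2}[x](subrK (q x)) innerDl qo // add0r.
exists (q \+ (q \- idfun)).
split=> /=.
- move=> x; have -> : q (q x + (q x - x)) = q x.
    by rewrite linearD linearB /= (qid (q x)) // subrr addr0.
  by rewrite opprD [q x + (- _ + _)]addrA subrr add0r opprB addrC subrK.
- by move=> x y; rewrite innerDl innerDr innerBl innerBr qsa.
- move=> i; have -> : q (e i) = 0; last by rewrite add0r sub0r.
  apply: quniq => [p|y oy]; first exact: inner0l.
  by rewrite subr0; apply: inner_eq0C; exact: (oy (i, 0%N)).
- by move=> y /qid ->; rewrite subrr addr0.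
move=> x; have -> : q (V x) = V (q x).
  apply: quniq => [|y oy]; first exact/orthV/qM.
  by rewrite -linearB V'P; apply: qo; apply: orthV'.
by rewrite !raddfD raddfN.
Qed.

End Projection.

(** * The Hilbert space of square-summable sequences *)

Section RealC.
Variable R : realType.

Lemma cvg_realC (u : nat -> R) (l : R) :
  u @ \oo --> l -> (fun n => (u n)%:C%C : R[i]^o) @ \oo --> (l%:C%C : R[i]^o).
Proof.
move=> /cvgrPdist_lt ul; apply/cvgrPdist_lt => _ /gt0_realC[e e0 ->].
near=> n; rewrite -rmorphB /= normc_def /= expr0n addr0 sqrtr_sqr ltcR.
by near: n; exact: ul.
Unshelve. all: by end_near. Qed.

Lemma cvg_conjC (u : nat -> R[i]^o) (l : R[i]^o) :
  u @ \oo --> l -> (fun n => Num.conj (u n) : R[i]^o) @ \oo --> (Num.conj l : R[i]^o).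
Proof.
move=> /cvgrPdist_lt ul; apply/cvgrPdist_lt => e e0.
by near=> n; rewrite -rmorphB norm_conjC; near: n; exact: ul.
Unshelve. all: by end_near. Qed.

End RealC.

Lemma polarization (R : realType) (V : lmodType R[i])
    (d : {dot V for @Num.conj R[i]}) (x y : V) :
  d x y = 4^-1 * (d (x + y) (x + y) - d (x - y) (x - y)
    + 'i%C * (d (x + 'i%C *: y) (x + 'i%C *: y) - d (x - 'i%C *: y) (x - 'i%C *: y))).
Proof.
rewrite !(innerDl, innerDr, innerNl, innerNr, innerZl, innerZr).
have ci : Num.conj ('i%C : R[i]) = - 'i%C by rewrite complexiE conjCi.
have ii : 'i%C * 'i%C = -1 :> R[i] by rewrite -expr2 sqr_i.
move: (d x x) (d x y) (d y x) (d y y) ('i%C : R[i]) ci ii => a b c e i -> ii.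
transitivity (4^-1 * (2 * b + 2 * c + 2 * (i * i) * (c - b))); last by ring.
by rewrite ii; field.
Qed.

Section Ell2.
Variables (R : realType) (H : hilbertType R).
Implicit Types (f g : nat -> H).

Definition psum f N : R := \sum_(n < N) sqn (f n).

Lemma psum_ge0 f N : 0 <= psum f N.
Proof. by apply: sumr_ge0 => n _; exact: sqn_ge0. Qed.

Lemma psumS f N : psum f N.+1 = psum f N + sqn (f N).
Proof. by rewrite /psum big_ord_recr. Qed.

Lemma psum_nd f : nondecreasing_seq (psum f).
Proof.
by apply/nondecreasing_seqP => n; rewrite psumS lerDl sqn_ge0.
Qed.

Definition ell2_pred : {pred (nat -> H)} :=
  fun f => `[< exists M : R, forall N, psum f N <= M >].

Lemma ell2_predP f :
  reflect (exists M : R, forall N, psum f N <= M) (f \in ell2_pred).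
Proof. exact: asboolP. Qed.

Lemma ell2_submod : GRing.submod_closed ell2_pred.
Proof.
split; first by apply/ell2_predP; exists 0 => N; rewrite /psum big1 // => i _; exact: sqn0.
move=> a f g /ell2_predP[Mf fM] /ell2_predP[Mg gM]; apply/ell2_predP.
exists (2 * (complex.Re (a * Num.conj a) * Mf) + 2 * Mg) => N.
apply: (@le_trans _ _ (2 * (complex.Re (a * Num.conj a) * psum f N) + 2 * psum g N)).
  rewrite /psum !mulr_sumr -big_split /=; apply: ler_sum => n _.
  apply: le_trans (sqnD_le2 _ _) _; rewrite lerD2r ler_pM2l //.
  rewrite /sqnorm_of innerZl innerZr mulrA sqnE.
  by case: (a * _) => u v /=; rewrite mulr0 subr0.
have a0 : 0 <= complex.Re (a * Num.conj a).
  by rewrite -ler0c RRe_real ?ger0_real // -normCK exprn_ge0.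
by rewrite lerD // ler_pM2l // ler_wpM2l.
Qed.

HB.instance Definition _ := GRing.isSubmodClosed.Build R[i] (nat -> H) ell2_pred ell2_submod.

Record ell2 := Ell2 { ell2_fun :> nat -> H; ell2_funP : ell2_fun \in ell2_pred }.

HB.instance Definition _ := [isSub for ell2_fun].
HB.instance Definition _ := [Choice of ell2 by <:].
HB.instance Definition _ := [SubChoice_isSubLmodule of ell2 by <:].

Implicit Types (x y z : ell2).

Arguments ell2_fun : simpl never.

Lemma ell2P x y : (forall n, x n = y n) -> x = y.
Proof. by move=> h; apply/val_inj/funext. Qed.

Lemma ell2D x y n : (x + y) n = x n + y n. Proof. by []. Qed.
Lemma ell2B x y n : (x - y) n = x n - y n. Proof. by []. Qed.
Lemma ell2Z (a : R[i]) x n : (a *: x) n = a *: x n. Proof. by []. Qed.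

Definition ell2_sq x : R := limn (psum x).

Lemma psum_cvg x : psum x @ \oo --> ell2_sq x.
Proof.
have /ell2_predP[M xM] := ell2_funP x.
suff h : cvgn (psum x) by exact: h.
apply: (nondecreasing_is_cvgn (@psum_nd x)).
by exists M => _ [N _ <-].
Qed.

Lemma psum_le x N : psum x N <= ell2_sq x.
Proof.
apply: (nondecreasing_cvgn_le (@psum_nd x)).
exact/cvgP/psum_cvg.
Qed.

Lemma ell2_sq_le x (M : R) : (forall N, psum x N <= M) -> ell2_sq x <= M.
Proof.
move=> h; apply: limr_le; first exact/cvgP/psum_cvg.
exact: nearW.
Qed.

Definition ipart x y N : R[i]^o := \sum_(n < N) inner (x n) (y n).

Lemma ipart_sq x N : ipart x x N = (psum x N)%:C%C.
Proof.
rewrite /ipart /psum rmorph_sum; apply: eq_bigr => n _; exact: sqnE.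
Qed.

Definition ell2_inner x y : R[i]^o := lim (ipart x y @ \oo).

Lemma ipart_cvg_sq x : ipart x x @ \oo --> ((ell2_sq x)%:C%C : R[i]^o).
Proof.
have := cvg_realC (@psum_cvg x).
by under eq_fun do rewrite -ipart_sq.
Qed.

(** By polarization the partial sums of <x, y> are combinations of partial sums
    of squared norms, which are monotone and bounded. *)
Lemma ipart_cvg x y : ipart x y @ \oo --> ell2_inner x y.
Proof.
suff [l hl] : exists l : R[i]^o, ipart x y @ \oo --> l by exact: (cvgP l hl).
pose t : R[i]^o := 4^-1.
exists (t * ((ell2_sq (x + y))%:C%C - (ell2_sq (x - y))%:C%C
  + 'i%C * ((ell2_sq (x + 'i%C *: y))%:C%C - (ell2_sq (x - 'i%C *: y))%:C%C))).
have -> : ipart x y = (fun N => t * (ipart (x + y) (x + y) N - ipart (x - y) (x - y) N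
  + 'i%C * (ipart (x + 'i%C *: y) (x + 'i%C *: y) N
          - ipart (x - 'i%C *: y) (x - 'i%C *: y) N))).
  apply/funext => N; rewrite /ipart -!sumrB !mulr_sumr -big_split mulr_sumr /=.
  by apply: eq_bigr => n _; exact: polarization.
apply: cvgMr; apply: cvgD; first by apply: cvgB; exact: ipart_cvg_sq.
by apply: cvgMr; apply: cvgB; exact: ipart_cvg_sq.
Qed.

Lemma ell2_inner_unique x y (l : R[i]^o) :
  ipart x y @ \oo --> l -> ell2_inner x y = l.
Proof. by move=> h; apply: cvg_lim. Qed.

Lemma ell2_innerC x y : ell2_inner x y = (-1) ^+ false * Num.conj (ell2_inner y x).
Proof.
rewrite mul1r; apply: ell2_inner_unique.
have -> : ipart x y = (fun n => Num.conj (ipart y x n) : R[i]^o).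
  apply/funext => N; rewrite /ipart rmorph_sum; apply: eq_bigr => n _.
  exact: innerC.
exact/cvg_conjC/ipart_cvg.
Qed.

Lemma ell2_inner_linear y (a : R[i]) x x' :
  ell2_inner (a *: x + x') y = a * ell2_inner x y + ell2_inner x' y.
Proof.
apply: ell2_inner_unique.
have -> : ipart (a *: x + x') y = (fun n => (a : R[i]^o) * ipart x y n + ipart x' y n).
  apply/funext => N; rewrite /ipart mulr_sumr -big_split /=; apply: eq_bigr => n _.
  by rewrite ell2D ell2Z innerDl innerZl.
by apply: cvgD; [apply: cvgMr|]; exact: ipart_cvg.
Qed.

Lemma ell2_inner_bilinear : bilinear_for
  (GRing.Scale.Law.clone _ _ ( *%R ) _) (GRing.Scale.Law.clone _ _ (Num.conj \; *%R ) _)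
  (ell2_inner : ell2 -> ell2 -> R[i]).
Proof.
split=> [y a x x'|y a x x']; first exact: ell2_inner_linear.
rewrite /= !(ell2_innerC y) !mul1r ell2_inner_linear.
by rewrite rmorphD rmorphM.
Qed.

HB.instance Definition _ := bilinear_isBilinear.Build R[i] ell2 ell2 R[i] _ _
  (ell2_inner : ell2 -> ell2 -> R[i]) ell2_inner_bilinear.

HB.instance Definition _ := isHermitianSesquilinear.Build R[i] ell2 false
  (@Num.conj R[i]) (ell2_inner : ell2 -> ell2 -> R[i]) ell2_innerC.

Lemma ell2_inner_sq x : ell2_inner x x = (ell2_sq x)%:C%C.
Proof. exact/ell2_inner_unique/ipart_cvg_sq. Qed.

Lemma ell2_le_sq x n : sqn (x n) <= ell2_sq x.
Proof.
apply: le_trans (psum_le x n.+1).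
by rewrite psumS lerDr psum_ge0.
Qed.

Lemma ell2_inner_gt0 x : x != 0 -> 0 < ell2_inner x x.
Proof.
move=> x0; rewrite ell2_inner_sq ltcR lt_def.
have p0 : 0 <= ell2_sq x by apply: le_trans (psum_ge0 x 0) (psum_le x 0).
rewrite p0 andbT; apply: contra_neq x0 => s0.
apply: ell2P => n; apply: (@sqn_eq0 _ _ inner); apply/le_anti.
by rewrite sqn_ge0 andbT -s0 ell2_le_sq.
Qed.

HB.instance Definition _ := isDotProduct.Build R[i] ell2
  (ell2_inner : ell2 -> ell2 -> R[i]) ell2_inner_gt0.

(** The form is sealed so that simplification does not replace the inner product
    of a Hilbert space by a limit. *)
Fact ell2_dot_subproof :
  {d : {dot ell2 for @Num.conj R[i]} | forall x y, d x y = ell2_inner x y}.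
Proof. by exists ell2_inner. Qed.

Definition ell2_dot := sval ell2_dot_subproof.

Lemma ell2_dotE x y : ell2_dot x y = ell2_inner x y.
Proof. exact: (svalP ell2_dot_subproof). Qed.

Lemma ell2_sqE x : ell2_sq x = sqnorm_of ell2_dot x.
Proof. by rewrite /sqnorm_of ell2_dotE ell2_inner_sq. Qed.

Definition ell2_norm x : R[i] := (Num.sqrt (ell2_sq x))%:C%C.

Lemma ell2_normD x y : ell2_norm (x + y) <= ell2_norm x + ell2_norm y.
Proof. by rewrite /ell2_norm -rmorphD lecR !ell2_sqE sqrt_sqnD. Qed.

Lemma ell2_normZ (a : R[i]) x : ell2_norm (a *: x) = `|a| * ell2_norm x.
Proof.
rewrite /ell2_norm; have -> : ell2_sq (a *: x) = complex.Re (a * Num.conj a) * ell2_sq x.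
  rewrite !ell2_sqE /sqnorm_of innerZl innerZr mulrA sqnE.
  by case: (a * _) => u v /=; rewrite mulr0 subr0.
rewrite -normCK normc_def -rmorphXn /= sqr_sqrtr ?addr_ge0 ?sqr_ge0 //.
by rewrite sqrtrM ?addr_ge0 ?sqr_ge0 // rmorphM.
Qed.

Lemma ell2_norm_eq0 x : ell2_norm x = 0 -> x = 0.
Proof.
move=> /complexI /eqP; rewrite sqrtr_eq0 => s0.
apply: (@sqn_eq0 _ _ ell2_dot); apply/le_anti.
by rewrite sqn_ge0 andbT -ell2_sqE.
Qed.

HB.instance Definition _ :=
  Lmodule_isNormed.Build R[i] ell2 ell2_normD ell2_normZ ell2_norm_eq0.

Lemma ell2_normE x : `|x| = (Num.sqrt (ell2_sq x))%:C%C.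
Proof. by []. Qed.

Lemma ell2_norm_lt x (e : R) : 0 < e -> (`|x| < e%:C%C) = (ell2_sq x < e ^+ 2).
Proof.
move=> e0; rewrite ell2_normE ltcR -{1}(ger0_norm (ltW e0)) -sqrtr_sqr.
by rewrite ltr_sqrt // exprn_gt0.
Qed.

(** Each coordinate of a Cauchy filter converges in H.  A partial sum of
    |y - z|^2, for y in a small set of the filter and z the coordinatewise limit,
    is compared with that of |y - w|^2 for some w in the same small set that is
    close to z in the finitely many coordinates involved. *)
Lemma ell2_complete (F : set_system ell2) : ProperFilter F -> cauchy F -> cvg F.
Proof.
move=> FF Fc.
have {}Fc (e : R) : 0 < e -> exists x, F [set y | ell2_sq (x - y) < e].
  move=> e0; have se0 : 0 < Num.sqrt e by rewrite sqrtr_gt0.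
  have [|x xF] := (cauchyP _).1 Fc (Num.sqrt e)%:C%C; first by rewrite ltcR.
  exists x; move: xF; apply: filterS => y; rewrite -ball_normE /=.
  by rewrite ell2_norm_lt // sqr_sqrtr ?ltW.
have coord n : exists z : H, forall e : R, 0 < e -> F [set y | sqn (y n - z) < e].
  pose G := (fun y : ell2 => y n) @ F.
  have Gc : cvg G.
    apply: cauchy_cvg; apply: cauchy_exP => _ /gt0_realC[e e0 ->].
    have [x xF] := Fc (e ^+ 2) (exprn_gt0 _ e0).
    exists (x n); change (F [set y : ell2 | ball (x n) e%:C%C (y n)]).
    apply: filterS xF => y /= xy; rewrite -ball_normE /=.
    by rewrite norm_lt_sqn //; apply: le_lt_trans xy; exact: (ell2_le_sq (x - y)).
  exists (lim G) => e e0.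
  have se0 : 0 < Num.sqrt e by rewrite sqrtr_gt0.
  move/cvgrPdist_lt: Gc => /(_ (Num.sqrt e)%:C%C); rewrite ltcR => /(_ se0).
  apply: filterS => y /=.
  by rewrite distrC norm_lt_sqn // sqr_sqrtr ?ltW.
have [z zP] := choice coord.
have near_z (e : R) : 0 < e ->
    F [set y : ell2 | forall N, psum (fun n => y n - z n) N <= e].
  move=> e0; have [|x xF] := Fc (e / 16); first by rewrite divr_gt0.
  move: (xF); apply: filterS => y /= xy N.
  have n0 : 0 < N.+1%:R :> R by rewrite ltr0n.
  have cN : F [set w : ell2 | forall i : 'I_N, sqn (w i - z i) < e / 4 / N.+1%:R].
    by apply: filter_forall => i; apply: zP; rewrite !divr_gt0.
  have [w [xw wz]] := filter_ex (filterI xF cN).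
  have yw : ell2_sq (y - w) <= e / 4.
    have -> : y - w = (x - w) - (x - y) by rewrite opprB [x - w + _]addrC addrA subrK.
    rewrite ell2_sqE; apply: le_trans (sqnD_le2 _ _) _; rewrite sqnN -!ell2_sqE.
    move: xw xy => /=; lra.
  apply: (@le_trans _ _ (2 * psum (y - w) N + 2 * psum (fun n => w n - z n) N)).
    rewrite /psum !mulr_sumr -big_split; apply: ler_sum => n _.
    have -> : y n - z n = (y - w) n + (w n - z n) by rewrite ell2B addrA subrK.
    exact: sqnD_le2.
  have h1 := le_trans (psum_le (y - w) N) yw.
  have h2 : psum (fun n => w n - z n) N <= e / 4.
    apply: (@le_trans _ _ (\sum_(n < N) (e / 4 / N.+1%:R))).
      by apply: ler_sum => n _; exact/ltW/wz.
    rewrite sumr_const card_ord -[leLHS]mulr_natr mulrAC ler_pdivrMr //.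
    by rewrite ler_pM2l ?divr_gt0 // ler_nat.
  move: h1 h2; lra.
have [y0 y0P] := filter_ex (near_z 1 ltr01).
have dP : (fun n => y0 n - z n) \in ell2_pred by apply/ell2_predP; exists 1.
pose zz : ell2 := y0 - Ell2 dP.
have zzE n : zz n = z n by rewrite ell2B /= subKr.
apply/cvg_ex; exists zz; apply/cvgrPdist_lt => _ /gt0_realC[e e0 ->].
have := near_z (e ^+ 2 / 2); rewrite divr_gt0 ?exprn_gt0 // => /(_ isT).
apply: filterS => y /= h; rewrite distrC ell2_norm_lt //.
apply: (@le_lt_trans _ _ (e ^+ 2 / 2)); last by have := exprn_gt0 2 e0; lra.
apply: ell2_sq_le => N; apply: le_trans (h N).
by apply: ler_sum => n _; rewrite ell2B zzE.
Qed.

HB.instance Definition _ := Uniform_isComplete.Build ell2 ell2_complete.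

Lemma ell2_inner_norm x : ell2_dot x x = `|x| ^+ 2.
Proof.
rewrite ell2_normE -rmorphXn /= sqr_sqrtr ?ell2_dotE ?ell2_inner_sq //.
by rewrite ell2_sqE sqn_ge0.
Qed.

HB.instance Definition _ :=
  NormedModule_isHilbert.Build R ell2 ell2_inner_norm.

End Ell2.

(** * Relabelling the coordinates *)

(** Sums of nonnegative terms do not depend on the order of the terms; this is
    the form in which unordered summation is used below. *)
Lemma sum_le_of_injection (R : realDomainType) (u v : nat -> R) (N : nat) (D : pred 'I_N)
    (k : 'I_N -> nat) :
  (forall m, 0 <= u m) -> (forall n n', D n -> D n' -> k n = k n' -> n = n') ->
  (forall n, D n -> v n = u (k n)) -> (forall n : 'I_N, ~~ D n -> v n = 0) ->
  exists M, \sum_(n < N) v n <= \sum_(m < M) u m.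
Proof.
move=> u0 kinj vu v0; pose M := (\max_(n < N) k n).+1; exists M.
have kM n : (k n < M)%N by rewrite ltnS leq_bigmax.
pose h n := Ordinal (kM n).
pose A : {set 'I_N} := finset D.
have -> : \sum_(n < N) v n = \sum_(n in A) u (h n).
  rewrite [RHS]big_mkcond; apply: eq_bigr => n _.
  by rewrite inE; case: ifPn => [/vu|/v0].
rewrite -(big_imset (fun m : 'I_M => u m)) /=; last first.
  by move=> n n'; rewrite !inE => Dn Dn' []; exact: kinj.
by rewrite big_mkcond; apply: ler_sum => m _; case: ifP.
Qed.

Section Operators.
Variables (R : realType) (H : hilbertType R).
Local Notation E := (ell2 H).
Implicit Types (x y : E) (phi : nat -> nat).

Lemma sqn_ell2 x : sqn x = ell2_sq x.
Proof. by rewrite ell2_sqE. Qed.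

Lemma inner_ell2_0 x y : (forall n, inner (x n) (y n) = 0) -> inner x y = 0.
Proof.
move=> h; rewrite [LHS]ell2_dotE; apply: ell2_inner_unique.
have -> : ipart x y = (fun=> 0) by apply/funext => N; rewrite /ipart big1.
exact: cvg_cst.
Qed.

Lemma ell2_ofP (f : nat -> H) (M : R) : (forall N, psum f N <= M) -> f \in @ell2_pred R H.
Proof. by move=> h; apply/ell2_predP; exists M. Qed.

Lemma ell2_linear (V : lmodType R[i]) (f : V -> E) :
  (forall n, linear (fun v => f v n)) -> linear f.
Proof. by move=> h a u v; apply: ell2P => n; rewrite h ell2D ell2Z. Qed.

Lemma pull_psum phi x N : injective phi -> psum (fun n => x (phi n)) N <= ell2_sq x.
Proof.
move=> inj.
have [|n n' _ _ /inj/val_inj //|//||M] := @sum_le_of_injection _ (fun n => sqn (x n))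
  (fun n => sqn (x (phi n))) N xpredT (fun n => phi n).
- by move=> m; exact: sqn_ge0.
- by [].
by move/le_trans; apply; exact: psum_le.
Qed.

Definition pinv phi (n : nat) : option nat :=
  if pselect (exists m, phi m = n) is left h then Some (projT1 (cid h)) else None.

Lemma pinvK phi : injective phi -> pcancel phi (pinv phi).
Proof.
move=> inj m; rewrite /pinv; case: pselect => [h|[]]; last by exists m.
by congr Some; apply: inj; exact: projT2 (cid h).
Qed.

Lemma pinv_Some phi n m : pinv phi n = Some m -> phi m = n.
Proof. by rewrite /pinv; case: pselect => // h [<-]; exact: projT2 (cid h). Qed.

(** For an injection phi of nat, [push] moves coordinate m to coordinate phi m
    and fills the other coordinates with zeros; it is an isometry, and its
    adjoint is composition with phi. *)
Definition push_fun phi x n : H := oapp x 0 (pinv phi n).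

Lemma push_psum phi x N : injective phi -> psum (push_fun phi x) N <= ell2_sq x.
Proof.
move=> inj; pose k (n : 'I_N) := odflt 0%N (pinv phi n).
have [||||M] := @sum_le_of_injection _ (fun n => sqn (x n))
  (fun n => sqn (push_fun phi x n)) N (fun n => pinv phi n) k.
- by move=> m; exact: sqn_ge0.
- move=> n n'; rewrite /k => Dn Dn' e; apply: val_inj => /=.
  case: (pinv phi n) Dn (@pinv_Some phi n) e => // m _ /(_ _ erefl) <-.
  by case: (pinv phi n') Dn' (@pinv_Some phi n') => // m' _ /(_ _ erefl) <- /= ->.
- by move=> n; rewrite /k /push_fun; case: (pinv phi n).
- by move=> n; rewrite /push_fun; case: (pinv phi n) => //= _; exact: sqn0.
by move/le_trans; apply; exact: psum_le.
Qed.

Variables (phi : nat -> nat) (phi_inj : injective phi).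

Definition pull x : E := Ell2 (ell2_ofP (fun N => pull_psum x N phi_inj)).
Definition push x : E := Ell2 (ell2_ofP (fun N => push_psum x N phi_inj)).

Lemma pullE x n : pull x n = x (phi n). Proof. by []. Qed.
Lemma pushE x m : push x (phi m) = x m.
Proof. by rewrite /push /ell2_fun /push_fun pinvK. Qed.
Lemma push0 x n : (forall m, phi m <> n) -> push x n = 0.
Proof.
move=> h; rewrite /push /ell2_fun /push_fun.
by case e: (pinv phi n) => [m|] //; have := h _ (pinv_Some e).
Qed.

Lemma in_range_or_not (n : nat) : {m | phi m = n} + (forall m, phi m <> n).
Proof.
case e : (pinv phi n) => [m|]; first by left; exists m; exact: pinv_Some.
by right=> m mn; move: e; rewrite -mn pinvK.
Qed.

Lemma pushK : cancel push pull.
Proof. by move=> x; apply: ell2P => n; rewrite pullE pushE. Qed.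

Lemma pull_linear : linear pull.
Proof. by apply: ell2_linear => n a x y; rewrite !pullE ell2D ell2Z. Qed.

Lemma push_linear : linear push.
Proof.
apply: ell2_linear => n a x y; have [[m <-]|h] := in_range_or_not n.
  by rewrite !pushE ell2D ell2Z.
by rewrite !push0 // scaler0 addr0.
Qed.

HB.instance Definition _ := GRing.isLinear.Build R[i] E E *:%R pull pull_linear.
HB.instance Definition _ := GRing.isLinear.Build R[i] E E *:%R push push_linear.

Lemma pull_sqn x : sqn (pull x) <= sqn x.
Proof. by rewrite !sqn_ell2; apply: ell2_sq_le => N; exact: pull_psum. Qed.

Lemma push_sqn x : sqn (push x) = sqn x.
Proof.
apply/le_anti/andP; split; last by rewrite -{1}[x]pushK pull_sqn.
by rewrite !sqn_ell2; apply: ell2_sq_le => N; exact: push_psum.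
Qed.

End Operators.

Section Isometries.
Variables (R : realType) (K L M : hilbertType R).

(** Norm identities become inner product identities by polarization. *)
Lemma isometry_pair (V : {linear K -> L}) (W : {linear K -> M}) :
  (forall x, sqn (V x) + sqn (W x) = sqn x) ->
  forall x y, inner (V x) (V y) + inner (W x) (W y) = inner x y.
Proof.
move=> h x y.
have e z : inner (V z) (V z) + inner (W z) (W z) = inner z z.
  by rewrite !sqnE -rmorphD h.
rewrite (polarization inner (V x)) (polarization inner (W x)) (polarization inner x).
rewrite -!linearZ -!linearD -!linearB -!e /=.
move: (inner _ _) (inner _ _) (inner _ _) (inner _ _) (inner _ _) (inner _ _)
 (inner _ _) (inner _ _) => a1 a2 a3 a4 a5 a6 a7 a8.
by ring.
Qed.

Lemma isometry_inner (V : {linear K -> L}) :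
  (forall x, sqn (V x) = sqn x) -> forall x y, inner (V x) (V y) = inner x y.
Proof.
move=> h x y; rewrite (polarization inner (V x)) (polarization inner x).
by rewrite -!linearZ -!linearD -!linearB !sqnE !h.
Qed.

End Isometries.

Section PushPull.
Variables (R : realType) (H : hilbertType R).
Local Notation E := (ell2 H).
Implicit Types (x y : E).

Section OneMap.
Variables (phi : nat -> nat) (inj : injective phi).

Lemma push_inner x y : inner (push inj x) (push inj y) = inner x y.
Proof. by apply: isometry_inner => {}x; exact: push_sqn. Qed.

Lemma push_pull x y : inner (push inj x) y = inner x (pull inj y).
Proof.
rewrite -[y in LHS](subrK (push inj (pull inj y))) innerDr push_inner.
rewrite [X in X + _]inner_ell2_0 ?add0r // => n.
have [[m <-]|h] := in_range_or_not inj n.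
  by rewrite ell2B (pushE _ (pull inj y)) pullE subrr inner0r.
by rewrite push0 // inner0l.
Qed.

Lemma push_fix (psi : nat -> nat) (inj' : injective psi) x :
  (forall m, psi (phi m) = phi m) -> push inj' (push inj x) = push inj x.
Proof.
move=> h; apply: ell2P => n; have [[m <-]|hn] := in_range_or_not inj n.
  by rewrite -{1}h !pushE.
rewrite [RHS]push0 //; have [[k kn]|hk] := in_range_or_not inj' n; last by rewrite push0.
rewrite -kn pushE push0 // => m mk; apply: (hn m).
by rewrite -kn -mk h.
Qed.

End OneMap.

Lemma push_orth (phi psi : nat -> nat) (inj : injective phi)
    (inj' : injective psi) x y :
  (forall m n, phi m <> psi n) -> inner (push inj x) (push inj' y) = 0.
Proof.
move=> h; rewrite push_pull; apply: inner_ell2_0 => n.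
by rewrite pullE push0 ?inner0r // => m /esym; exact: h.
Qed.

Definition emb_fun (h : H) (n : nat) : H := if n == 0%N then h else 0.

Lemma emb_psum h N : psum (emb_fun h) N <= sqn h.
Proof.
case: N => [|N]; rewrite /psum ?big_ord0 ?sqn_ge0 // big_ord_recl big1 ?addr0 //.
by move=> i _; exact: sqn0.
Qed.

Definition emb (h : H) : E := Ell2 (ell2_ofP (emb_psum h)).
Definition prj (x : E) : H := x 0%N.

Lemma emb_linear : linear emb.
Proof.
apply: ell2_linear => n a h h'; rewrite /emb /ell2_fun /emb_fun.
by case: eqP => //; rewrite scaler0 addr0.
Qed.
HB.instance Definition _ := GRing.isLinear.Build R[i] H E *:%R emb emb_linear.

Lemma prj_linear : linear prj. Proof. by []. Qed.
HB.instance Definition _ := GRing.isLinear.Build R[i] E H *:%R prj prj_linear.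

Lemma embK : cancel emb prj. Proof. by []. Qed.

Lemma emb_inner h h' : inner (emb h) (emb h') = inner h h'.
Proof.
move: h h'; apply: isometry_inner => h; apply/le_anti/andP; split.
  by rewrite sqn_ell2; apply: ell2_sq_le; exact: emb_psum.
by rewrite sqn_ell2 -[h in leLHS]embK ell2_le_sq.
Qed.

Lemma emb_prj h x : inner (emb h) x = inner h (prj x).
Proof.
rewrite -[x in LHS](subrK (emb (prj x))) innerDr emb_inner.
rewrite [X in X + _]inner_ell2_0 ?add0r // => -[|n].
  by rewrite ell2B -/(prj _) -/(prj x) -/(prj (emb _)) embK subrr inner0r.
by rewrite /emb {1}/ell2_fun /= inner0l.
Qed.

Lemma prj_emb h x : inner x (emb h) = inner (prj x) h.
Proof. by rewrite innerC emb_prj -innerC. Qed.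

Lemma prj_push_fix phi (inj : injective phi) x : phi 0%N = 0%N -> prj (push inj x) = prj x.
Proof. by move=> h; rewrite /prj -{1}h pushE. Qed.

Lemma prj_pull_fix phi (inj : injective phi) x : phi 0%N = 0%N -> prj (pull inj x) = prj x.
Proof. by move=> h; rewrite /prj pullE h. Qed.

Lemma prj_push0 phi (inj : injective phi) x : (forall m, phi m <> 0%N) -> prj (push inj x) = 0.
Proof. by move=> h; rewrite /prj push0. Qed.

Lemma push_emb phi (inj : injective phi) h : phi 0%N = 0%N -> push inj (emb h) = emb h.
Proof.
move=> p0; apply: ell2P => n; rewrite {2}/emb {2}/ell2_fun /emb_fun.
have [[m <-]|hn] := in_range_or_not inj n; last first.
  by rewrite push0 //; case: eqP => // n0; case: (hn 0%N); rewrite n0.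
rewrite pushE /emb /ell2_fun /emb_fun; congr (if _ then _ else _).
by rewrite -{2}p0 (inj_eq inj).
Qed.

End PushPull.

Arguments emb : simpl never.
Arguments prj : simpl never.
Arguments push : simpl never.
Arguments pull : simpl never.

(** * Defect operators *)

Section Defect.
Variables (R : realType) (H : hilbertType R) (T : {linear H -> H}).
Hypothesis T_contr : forall x, sqn (T x) <= sqn x.

(** The operator D h = (R_n h)_n is a sequence of polynomials in T' T, where T' is
    the adjoint of T: put R_0 = 1 - T' T and R_(n+1) = R_n - R_n^2.  From
    R - R^2 = R (1 - R) R + (1 - R) R (1 - R) all R_n lie between 0 and 1, and
    telescoping gives
    |R_0 h|^2 + ... + |R_(N-1) h|^2 = <R_0 h, h> - <R_N h, h>.
    As the left-hand sides are bounded, R_n h has arbitrarily small norms, hence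
    <R_N h, h> tends to 0 and the sequence (R_n h)_n has squared norm
    <R_0 h, h> = |h|^2 - |T h|^2. *)
Lemma defect_exists : exists D : {linear H -> ell2 H},
  forall x y, inner (D x) (D y) + inner (T x) (T y) = inner x y.
Proof.
have [|T' T'P] := @adjoint_exists _ _ _ T.
  by exists 1 => x; rewrite mul1r.
pose Rn := fix Rn (n : nat) (h : H) : H :=
  if n is m.+1 then Rn m h - Rn m (Rn m h) else h - T' (T h).
have Rn0 h : Rn 0%N h = h - T' (T h) by [].
have RnS n h : Rn n.+1 h = Rn n h - Rn n (Rn n h) by [].
pose q n h : R := complex.Re (inner (Rn n h) h).
have Rlin n : linear (Rn n).
  elim: n => [|n IH] a x y; first by rewrite !Rn0 (linearP T) (linearP T') opprD addrACA -scalerBr.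
  by rewrite !RnS !IH opprD addrACA -scalerBr.
have Rsa n x y : inner (Rn n x) y = inner x (Rn n y).
  elim: n x y => [|n IH] x y.
    rewrite !Rn0 innerBl innerBr -T'P; congr (_ - _).
    by rewrite innerC -T'P -innerC.
  by rewrite !RnS innerBl innerBr !IH.
have qS n h : q n.+1 h = q n h - sqn (Rn n h).
  by rewrite /q RnS innerBl raddfB /= (Rsa n (Rn n h)).
have q0 h : q 0%N h = sqn h - sqn (T h).
  by rewrite /q Rn0 innerBl [X in _ - X]innerC -T'P -innerC raddfB.
have qbd n h : 0 <= q n h <= sqn h.
  elim: n h => [|n IH] h.
    by rewrite q0 subr_ge0 T_contr gerBl sqn_ge0.
  rewrite qS; apply/andP; split; last first.
    by apply: le_trans (_ : q n h <= _); [rewrite gerBl sqn_ge0|case/andP: (IH h)].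
  have /andP[_ u1] := IH (Rn n h); have /andP[w0 _] := IH (h - Rn n h).
  have : q n (h - Rn n h) = q n h - 2 * sqn (Rn n h) + q n (Rn n h).
    rewrite /q.
    have -> : Rn n (h - Rn n h) = Rn n h - Rn n (Rn n h).
      by have := Rlin n (-1) (Rn n h) h; rewrite !scaleN1r ![- _ + _]addrC.
    rewrite innerBl !innerBr !raddfB /= (Rsa n (Rn n h) h) /sqnorm_of; ring.
  lra.
have psumE h N : psum (fun n => Rn n h) N = q 0%N h - q N h.
  elim: N => [|N IH]; first by rewrite /psum big_ord0 subrr.
  by rewrite psumS IH qS; ring.
have DP h N : psum (fun n => Rn n h) N <= q 0%N h.
  by rewrite psumE gerBl; case/andP: (qbd N h).
pose D h : ell2 H := Ell2 (ell2_ofP (DP h)).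
have Dlin : linear D by apply: ell2_linear => n; exact: Rlin.
have qsmall h (e : R) : 0 < e -> exists N, q N h <= e.
  move=> e0; apply: contrapT => /forallNP hN.
  have big N : e ^+ 2 * N%:R <= sqn h * q 0%N h.
    apply: le_trans (ler_wpM2l (sqn_ge0 h) (DP h N)).
    rewrite /psum mulr_sumr -[N in leLHS]card_ord -sumr_const mulr_sumr.
    apply: ler_sum => n _; rewrite mulr1 mulrC.
    apply: le_trans (cauchy_schwarz_Re _ _).
    rewrite ler_pXn2r ?nnegrE ?(ltW e0) //; last by case/andP: (qbd n h).
    by rewrite leNgt; apply/negP => /ltW; exact: hN.
  have e2 : 0 < e ^+ 2 by rewrite exprn_gt0.
  have b0 : 0 <= (sqn h * q 0%N h) / e ^+ 2.
    have /andP[q00 _] := qbd 0%N h.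
    by rewrite divr_ge0 ?mulr_ge0 ?sqn_ge0 // ltW.
  have := archi_boundP b0; rewrite ltr_pdivrMr // [X in _ < X]mulrC ltNge.
  by rewrite big.
have [D' D'E] := linear_bundle Dlin; exists D'.
apply: isometry_pair => h; rewrite D'E sqn_ell2.
suff -> : ell2_sq (D h) = q 0%N h by rewrite q0 subrK.
apply/le_anti/andP; split; first by apply: ell2_sq_le => N; exact: DP.
apply/ler_addgt0Pl => e /(qsmall h)[N qN].
apply: le_trans (lerD qN (psum_le (D h) N)).
by rewrite psumE addrC subrK.
Qed.

End Defect.

(** * Reflections that match isometric lifts *)

Section Lifting.
Variables (R : realType) (K : hilbertType R).

Definition isom (V : K -> K) : Prop := forall x y, inner (V x) (V y) = inner x y.

Lemma isom_bounded (V : K -> K) : isom V -> bounded_lin V.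
Proof. by move=> iV; exists 1 => x; rewrite mul1r /sqnorm_of iV. Qed.

Lemma exchange_of_eigenvectors (rho : {linear K -> K}) a b :
  rho (a + b) = a + b -> rho (a - b) = - (a - b) -> rho a = b.
Proof.
move=> hp hm; apply: (@scalerI _ _ (2 : R[i])) => //.
rewrite -linearZ /=; have -> : 2 *: a = (a + b) + (a - b).
  by rewrite addrACA subrr addr0 scaler_nat mulr2n.
by rewrite linearD /= hp hm opprB [a + b]addrC addrACA subrr addr0 scaler_nat mulr2n.
Qed.

Variables (H : hilbertType R) (J : {linear H -> K}) (P : {linear K -> H}).
Hypothesis JP : forall h x, inner (J h) x = inner h (P x).
Hypothesis PK : forall h, P (J h) = h.

(** In terms of adjoints: the adjoint of V maps the copy of H into itself, and
    acts there as the adjoint of T. *)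
Definition lifts (T : H -> H) (V : K -> K) : Prop := forall x, P (V x) = T (P x).

Lemma innerPJ x h : inner x (J h) = inner (P x) h.
Proof. by rewrite innerC JP -innerC. Qed.

(** The reflection is the one for the operator V that vanishes on H and agrees
    with X, that is with Y, on the complement of H, and for the vectors
    e h = X h - Y h.  The condition on inner products makes X h + Y h orthogonal
    to the orbit, so that the reflection exchanges X h and Y h. *)
Lemma intertwine (X Y : {linear K -> K}) (A : {linear H -> H}) :
  isom X -> isom Y -> lifts A X -> lifts A Y ->
  (forall x, P x = 0 -> X x = Y x) ->
  (forall h h', inner (X (J h)) (Y (J h')) = inner (A h) (A h')) ->
  exists C : {linear K -> K},
    [/\ forall x, C (C x) = x, isom C, forall h, C (J h) = J h,
        forall x, P (C x) = P x & forall x, C (X x) = Y (C x)].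
Proof.
move=> iX iY lX lY XY cross.
have [V VE] : exists V : {linear K -> K}, forall x, V x = X (x - J (P x)).
  by exists (X \o (idfun \- (J \o P))).
have P0 x : P (x - J (P x)) = 0 by rewrite linearB /= PK subrr.
have V0 x : P x = 0 -> V x = X x by move=> Px; rewrite VE Px linear0 subr0.
have PV x : P (V x) = 0 by rewrite VE lX P0 linear0.
pose e h := X (J h) - Y (J h).
have Pe h : P (e h) = 0 by rewrite linearB /= lX lY subrr.
have Pit h n : P (iter n V (e h)) = 0 by case: n => [|n]; [exact: Pe|exact: PV].
have Vb : bounded_lin V.
  exists 1 => x; rewrite mul1r VE /sqnorm_of iX.
  rewrite innerBl !innerBr !JP innerPJ PK subrr subr0 raddfB /= gerBl.
  exact: sqn_ge0.
have [|C [CC Csa Ce Cfix CV]] := @reflection R K H e V Vb.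
  move=> y oy [h [|n]] /=.
    rewrite VE /e innerBr iX XY // iY subrr //.
  rewrite (V0 _ (Pit h n)) VE iX innerBl JP Pit inner0r subr0.
  exact: (oy (h, n)).
have CJ h : C (J h) = J h by apply: Cfix => -[h' n]; rewrite JP Pit inner0r.
have PC x : P (C x) = P x.
  by apply: inner_inj => h; rewrite -!JP -Csa CJ.
exists C; split=> //; first by move=> x y; rewrite Csa CC.
have Csum h : C (X (J h) + Y (J h)) = X (J h) + Y (J h).
  apply: Cfix => -[h' [|n]] /=.
    rewrite innerDl !innerBr iX iY !cross (innerC (Y _)) cross -innerC.
    by rewrite !JP !PK addrC addrA subrK subrr.
  rewrite (V0 _ (Pit h' n)) innerDl iX XY // iY.
  by rewrite JP Pit inner0r addr0.
have CX h : C (X (J h)) = Y (J h) by apply: exchange_of_eigenvectors; [exact: Csum|exact: Ce].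
move=> x; rewrite -{1}[x](subrK (J (P x))) linearD /= -VE linearD /= CV CX VE PC.
by rewrite XY; [rewrite -linearD subrK|rewrite linearB /= PC PK subrr].
Qed.

Variables (i0 i1 p0 p1 : {linear K -> K}).
Hypothesis ip0 : forall x y, inner (i0 x) y = inner x (p0 y).
Hypothesis ip1 : forall x y, inner (i1 x) y = inner x (p1 y).
Hypothesis p00 : forall x, p0 (i0 x) = x.
Hypothesis p11 : forall x, p1 (i1 x) = x.
Hypothesis p01 : forall x, p0 (i1 x) = 0.
Hypothesis p10 : forall x, p1 (i0 x) = 0.
Hypothesis ipD : forall x, i0 (p0 x) + i1 (p1 x) = x.
Hypothesis i0J : forall h, i0 (J h) = J h.

Lemma P_p0 x : P (p0 x) = P x.
Proof. by apply: inner_inj => h; rewrite -!JP -ip0 i0J. Qed.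

Definition dsum (A B : {linear K -> K}) : {linear K -> K} :=
  (i0 \o A \o p0) \+ (i1 \o B \o p1).

Lemma dsumE A B x : dsum A B x = i0 (A (p0 x)) + i1 (B (p1 x)).
Proof. by []. Qed.

Lemma p0_dsum A B x : p0 (dsum A B x) = A (p0 x).
Proof. by rewrite dsumE linearD /= p00 p01 addr0. Qed.

Lemma p1_dsum A B x : p1 (dsum A B x) = B (p1 x).
Proof. by rewrite dsumE linearD /= p10 p11 add0r. Qed.

Lemma dsum_isom (A B : {linear K -> K}) : isom A -> isom B -> isom (dsum A B).
Proof.
move=> iA iB x y; rewrite {1}dsumE innerDl ip0 ip1 p0_dsum p1_dsum iA iB.
by rewrite -ip0 -ip1 -innerDl ipD.
Qed.

Lemma dsum_lifts (T : {linear H -> H}) (A B : {linear K -> K}) : lifts T A -> lifts T (dsum A B).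
Proof. by move=> lA x; rewrite -P_p0 p0_dsum lA P_p0. Qed.

(** The reflection is the one for V1 + V2 and the vectors e h = (h, -h); the
    vectors (h, h) are orthogonal to the orbit of e, because
    <h, V1^n h'> = <h, T^n h'> = <h, V2^n h'>. *)
Lemma amalgam (T : {linear H -> H}) (V1 V2 : {linear K -> K}) :
  isom V1 -> isom V2 -> lifts T V1 -> lifts T V2 ->
  exists rho : {linear K -> K},
    [/\ forall x, rho (rho x) = x, isom rho,
        forall h, rho (J h) = i1 (J h),
        forall x, P (rho x) = P (p1 x) &
        forall x, rho (dsum V1 V2 x) = dsum V1 V2 (rho x)].
Proof.
move=> iV1 iV2 lV1 lV2; set V := dsum V1 V2.
have iV : isom V by exact: dsum_isom.
pose e h := J h - i1 (J h).
have it h n : P (p0 (iter n V (e h))) + P (p1 (iter n V (e h))) = 0.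
  elim: n => [|n IH] /=.
    rewrite !linearB /= p01 p11 P_p0 linear0 subr0 -[in P (p1 (J h))]i0J p10.
    by rewrite linear0 sub0r subrr.
  by rewrite /V p0_dsum p1_dsum lV1 lV2 -linearD IH linear0.
have [|rho [rr rsa re rfix rV]] := @reflection R K H e V (isom_bounded iV).
  move=> y oy [h [|n]] /=; last by rewrite iV; exact: (oy (h, n)).
  have Py : P (p0 y) = P (p1 y).
    apply: inner_inj => z; rewrite -!JP -ip0 -ip1 i0J; apply/eqP.
    by rewrite -subr_eq0 -innerBl; apply/eqP/inner_eq0C; exact: (oy (z, 0%N)).
  rewrite innerBr innerPJ (dsum_lifts V2 lV1) -P_p0 Py [X in _ - X]innerC ip1 JP.
  by rewrite p1_dsum lV2 -innerC subrr.
have rs h : rho (J h + i1 (J h)) = J h + i1 (J h).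
  apply: rfix => -[h' n] /=; rewrite innerDl JP -P_p0 ip1 JP -innerDr it.
  exact: inner0r.
have rJ h : rho (J h) = i1 (J h) by apply: exchange_of_eigenvectors; [exact: rs|exact: re].
exists rho; split=> // [x y|x]; first by rewrite rsa rr.
by apply: inner_inj => h; rewrite -!JP -rsa rJ ip1.
Qed.

End Lifting.

(** * Lifting one commutation relation *)

(** The boolean chooses between the two positions of the twist, so that both parts
    of the theorem have one proof. *)
Definition qcomm (b : bool) (K : Type) (A B Q : K -> K) : Prop :=
  forall x, A (B x) = if b then Q (B (A x)) else B (Q (A x)).

Definition contractive (R : realType) (H : hilbertType R) (T : H -> H) : Prop :=
  forall x, sqn (T x) <= sqn x.

(** The direct sum of Q and the identity, on H and its complement. *)
Definition oplus_id (R : realType) (H : hilbertType R) (Q : H -> H)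
    (Qb : ell2 H -> ell2 H) : Prop :=
  forall x, Qb x = emb (Q (prj x)) + (x - emb (prj x)).

Section Pair.
Variables (R : realType) (H : hilbertType R).
Local Notation E := (ell2 H).
Local Notation J := (@emb R H).
Local Notation P := (@prj R H).

(** The first step of the Schaffer construction, with the shift s left open: the
    three summands have orthogonal ranges. *)
Lemma schaffer_lift (T : {linear H -> H}) (d : {linear H -> E}) (s : {linear E -> E}) :
  (forall h h', inner (d h) (d h') + inner (T h) (T h') = inner h h') ->
  isom s -> (forall h, P (d h) = 0) -> (forall x, P x = 0 -> P (s x) = 0) ->
  (forall x h, inner (s x) (d h) = 0) ->
  exists V : {linear E -> E},
    [/\ forall x, V x = J (T (P x)) + d (P x) + s (x - J (P x)), isom V & lifts P T V].
Proof.
move=> dT is_ Pd Ps sd.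
have P0 x : P (x - J (P x)) = 0 by rewrite linearB /= embK subrr.
exists (((J \o T \o P) \+ (d \o P)) \+ (s \o (idfun \- (J \o P)))); split=> //.
- move=> x y /=.
  rewrite !innerDl !innerDr is_ !emb_prj !prj_emb !sd.
  rewrite embK !Pd !(Ps _ (P0 _)) !(inner_eq0C (sd _ _)) inner0r !inner0l.
  rewrite !addr0 !add0r [inner (T _) _ + _]addrC dT.
  rewrite innerBl !innerBr !emb_prj !prj_emb embK subrr subr0.
  by rewrite addrC subrK.
- move=> x /=; have PD u v : P (u + v) = P u + P v by rewrite linearD.
  by rewrite !PD embK Pd Ps ?addr0.
Qed.

(** The coordinates other than 0 fall into the residue classes modulo 4: slots 0,
    1, 2 are the classes of 1, 2, 3, and the positive multiples of 4 form a fourth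
    class, left to the twist. *)
Definition slot (k m : nat) : nat := (4 * m + k.+1)%N.

Lemma slot_inj k : injective (slot k).
Proof. by move=> m n; rewrite /slot; lia. Qed.

Local Notation U k := (push (@slot_inj k)).

Lemma slot_neq0 k m : slot k m <> 0%N.
Proof. by rewrite /slot; lia. Qed.

Lemma slot_disj k l m n : (k < 3)%N -> (l < 3)%N -> k != l -> slot k m <> slot l n.
Proof. by rewrite /slot; lia. Qed.

Lemma U_orth k l (x y : E) : (k < 3)%N -> (l < 3)%N -> k != l -> inner (U k x) (U l y) = 0.
Proof. by move=> k3 l3 kl; apply: push_orth => m n; exact: slot_disj. Qed.

Lemma P_U k (x : E) : P (U k x) = 0.
Proof. by apply: prj_push0 => m; exact: slot_neq0. Qed.

(** Slot k receives the defect part of the lift, slot 0 everything that was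
    orthogonal to H. *)
Lemma slot_lift (T : {linear H -> H}) k : contractive T -> (0 < k < 3)%N ->
  exists (D : {linear H -> E}) (V : {linear E -> E}),
    [/\ forall x, V x = J (T (P x)) + U k (D (P x)) + U 0%N (x - J (P x)),
        isom V & lifts P T V].
Proof.
move=> cT /andP[k0 k3]; have [D DT] := defect_exists cT; exists D.
apply: (@schaffer_lift T (U k \o D) (U 0%N)) => /=.
- by move=> h h'; rewrite push_inner.
- exact: push_inner.
- by move=> h; exact: P_U.
- by move=> x _; exact: P_U.
- by move=> x h; apply: U_orth => //; lia.
Qed.

(** Within the positive multiples of 4, [shift4] is an injection whose range misses
    [spare]; it fixes all other coordinates.  A twist which is not isometric thus
    has its defect part in [spare], and is the identity on the slots 0, 1, 2. *)
Definition spare (m : nat) : nat := (8 * m + 8)%N.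
Lemma spare_inj : injective spare.
Proof. by move=> m n; rewrite /spare; lia. Qed.

Definition shift4 (n : nat) : nat :=
  if ((4 %| n) && (0 < n))%N then (2 * n - 4)%N else n.
Lemma shift4_inj : injective shift4.
Proof. by move=> m n; rewrite /shift4; case: ifP; case: ifP; lia. Qed.

Lemma twist_lift (Q : {linear H -> H}) : contractive Q ->
  exists Qb : {linear E -> E},
    [/\ isom Qb, lifts P Q Qb,
        forall k x, (k < 3)%N -> Qb (U k x) = U k x,
        forall k h x, (k < 3)%N -> inner (Qb (J h)) (U k x) = 0 &
        isom Q -> oplus_id Q Qb].
Proof.
move=> cQ.
have JU k h (x : E) : inner (J h) (U k x) = 0 by rewrite emb_prj P_U inner0r.
have [iQ|niQ] := pselect (isom Q).
  have [|||||Qb [QbE iQb lQb]] := @schaffer_lift Q \0 idfun.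
  - by move=> h h'; rewrite inner0l add0r iQ.
  - by [].
  - by move=> h; rewrite linear0.
  - by [].
  - by move=> x h; rewrite inner0r.
  exists Qb; split=> // [k x _|k h x _|_ x].
  - by rewrite QbE /= P_U !linear0 !add0r addr0.
  - by rewrite QbE /= embK subrr !addr0 JU.
  - by rewrite QbE /= addr0.
have [D DQ] := defect_exists cQ.
have [|||||Qb [QbE iQb lQb]] := @schaffer_lift Q (push spare_inj \o D) (push shift4_inj).
- by move=> h h' /=; rewrite push_inner.
- exact: push_inner.
- by move=> h /=; apply: prj_push0 => m; rewrite /spare; lia.
- by move=> x Px; rewrite prj_push_fix.
- move=> x h /=; apply: push_orth => m n; rewrite /shift4 /spare.
  by case: ifP; lia.
exists Qb; split=> // [k x k3|k h x k3].
- rewrite QbE P_U !linear0 add0r add0r addr0; apply: push_fix => m.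
  by rewrite /shift4 /slot; case: ifP => //; lia.
- rewrite QbE embK subrr linear0 addr0 innerDl JU add0r.
  by apply: push_orth => m n; rewrite /spare /slot; lia.
Qed.

(** On the complement of H, both X and Y apply U 0 twice, because the lifted
    twist fixes the slots.  On H, the defect parts of X lie in slot 1 and in slot 2
    shifted into slot 0; those of Y lie in slot 2, in slot 1 shifted into slot 0,
    and in the coordinates of the twist or their shifts into slot 0.  So
    [intertwine] applies, and C X C = Y is the relation for C V1 and V2 C. *)
Lemma pair_lift (b : bool) (T1 T2 Q : {linear H -> H}) :
  contractive T1 -> contractive T2 -> contractive Q -> qcomm b T1 T2 Q ->
  exists W1 W2 Qb : {linear E -> E},
    [/\ isom W1 /\ lifts P T1 W1, isom W2 /\ lifts P T2 W2,
        isom Qb /\ lifts P Q Qb, isom Q -> oplus_id Q Qb & qcomm b W1 W2 Qb].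
Proof.
move=> c1 c2 cQ TQ.
have [D1 [V1 [V1E i1 l1]]] := @slot_lift T1 1%N c1 isT.
have [D2 [V2 [V2E i2 l2]]] := @slot_lift T2 2%N c2 isT.
have [Qb [iQ lQ QU QO QI]] := twist_lift cQ.
have JU k h (x : E) : inner (J h) (U k x) = 0 by rewrite emb_prj P_U inner0r.
have V1k x : P x = 0 -> V1 x = U 0%N x by move=> Px; rewrite V1E Px !linear0 !add0r addr0.
have V2k x : P x = 0 -> V2 x = U 0%N x by move=> Px; rewrite V2E Px !linear0 !add0r addr0.
pose X : {linear E -> E} := V1 \o V2.
pose Y : {linear E -> E} := if b then (Qb \o (V2 \o V1) : {linear E -> E})
  else (V2 \o (Qb \o V1) : {linear E -> E}).
have [] := @intertwine R E H J P (@emb_prj R H) (@embK R H) X Y (T1 \o T2).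
- by move=> x y; rewrite /= i1 i2.
- by rewrite /Y; case: (b) => x y /=; rewrite ?iQ i2 ?iQ i1.
- by move=> x /=; rewrite l1 l2.
- by move=> x; rewrite [RHS]TQ /Y; case: (b) => /=; rewrite ?lQ l2 ?lQ l1.
- move=> x Px; rewrite /X /Y /= V2k // V1k ?P_U //.
  by case: (b) => /=; rewrite V1k // ?QU // V2k ?P_U // QU.
- move=> h h'; rewrite /X /= V2E embK subrr linear0 addr0 linearD /=.
  rewrite V1E embK subrr linear0 addr0 (V1k (U 2%N _)) ?P_U //.
  have TQ' : T1 (T2 h') = if b then Q (T2 (T1 h')) else T2 (Q (T1 h')) by exact: TQ.
  have PY : P (Y (J h')) = T1 (T2 h').
    by rewrite TQ' /Y; case: (b) => /=; rewrite ?lQ l2 ?lQ l1.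
  rewrite !innerDl emb_prj PY -addrA -[RHS]addr0; congr (_ + _).
  rewrite /Y; case: (b) => /=.
    rewrite V1E embK subrr linear0 addr0 linearD /= (V2k (U 1%N _)) ?P_U //.
    rewrite V2E embK subrr linear0 addr0 !linearD /= !QU //.
    rewrite !(inner_eq0C (QO _ _ _ _)) // push_inner !U_orth //.
    by rewrite !addr0.
  rewrite V1E embK subrr linear0 addr0 linearD /= QU // linearD /= (V2k (U 1%N _)) ?P_U //.
  have lQ' x : P (Qb x) = Q (P x) := lQ x.
  rewrite V2E lQ' embK ?innerDr !(inner_eq0C (JU _ _ _)) !push_inner.
  rewrite innerBr (inner_eq0C (QO _ _ _ _)) // (inner_eq0C (JU _ _ _)) !U_orth //.
  by rewrite subrr !addr0.
move=> C [CC iC CJ PC CXY].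
have YX x : C (Y x) = X (C x) by rewrite -{1}[x]CC -CXY CC.
exists (C \o V1), (V2 \o C), (if b then Qb else (C \o (Qb \o C) : {linear E -> E})).
have lC1 : isom (C \o V1) /\ lifts P T1 (C \o V1).
  by split=> [x y|x] /=; rewrite ?PC ?l1 // iC i1.
have lC2 : isom (V2 \o C) /\ lifts P T2 (V2 \o C).
  by split=> [x y|x] /=; rewrite ?l2 ?PC // i2 iC.
have CXC x : C (V1 (V2 (C x))) = Y x by rewrite -[LHS]/(C (X (C x))) CXY CC.
rewrite /Y in CXC; split=> //.
- case: (b) => //; split=> [x y|x] /=; first by rewrite iC iQ iC.
  by rewrite PC lQ PC.
- move=> /QI QE; case: (b) => // x /=; by rewrite QE PC linearD linearB /= !CJ CC.
- by move=> x /=; rewrite CXC; case: (b) => /=; rewrite !CC.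
Qed.

End Pair.

(** * Growing the tree *)

Section Growth.
Variables (n : nat) (G : sgraph n).
Implicit Types S : {set 'I_n}.

Definition inside S : rel 'I_n := [rel u v | [&& G u v, u \in S & v \in S]].

Definition connected_in S : Prop :=
  forall u v, u \in S -> v \in S -> connect (inside S) u v.

Lemma crossing_edge S a z : connect G a z -> a \in S -> z \notin S ->
  exists u v, [/\ u \in S, v \notin S & G u v].
Proof.
case/connectP => p; elim: p a => [|c p IH] a /=; first by move=> _ -> ->.
case/andP=> ac cp zl aS zS; have [cS|cS] := boolP (c \in S).
  exact: (IH c).
by exists a, c.
Qed.

Lemma path_inside S u p : path (inside S) u p -> all (mem S) p.
Proof.
by elim: p u => //= c p IH u /andP[/and3P[_ _ cS] /IH ->]; rewrite andbT.
Qed.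

(** Two neighbours of y in S, joined by a simple path inside S, would close up to a
    cycle through y. *)
Lemma unique_neighbour S y u u' : acyclic G -> connected_in S ->
  y \notin S -> u \in S -> u' \in S -> G u y -> G u' y -> u = u'.
Proof.
move=> acyc conS yS uS u'S uy u'y; apply/eqP; apply: contrapT => /negP uu'.
have /connectP[p0 p0path p0l] := conS _ _ uS u'S.
case/shortenP: p0path p0l => p pp up _ pl.
apply: (acyc (y :: u :: p)).
  by case: p pp up pl => //= _ _ u'u; rewrite u'u eqxx in uu'.
have pS : all (mem S) (u :: p).
  by rewrite /= uS (path_inside pp).
have pG : path G u p by apply: sub_path pp => a c /and3P[].
rewrite /ucycle /ucycleb; apply/andP; split; last first.
  rewrite cons_uniq up andbT; apply/negP => yp.
  by move/allP: pS => /(_ y yp) /= yS'; rewrite yS' in yS.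
by rewrite /= rcons_path pG -pl u'y adj_sym uy.
Qed.

Lemma connected_in_grow S u y : connected_in S -> u \in S -> G u y ->
  connected_in (y |: S).
Proof.
move=> conS uS uy.
have sub a c : a \in S -> c \in S -> connect (inside (y |: S)) a c.
  move=> aS cS; apply: connect_sub (conS _ _ aS cS) => v w /and3P[vw vS wS].
  by apply: connect1; rewrite /inside /= vw !inE vS wS !orbT.
have uy1 : connect (inside (y |: S)) u y.
  by apply: connect1; rewrite /inside /= uy !inE uS eqxx orbT.
have yu1 : connect (inside (y |: S)) y u.
  by apply: connect1; rewrite /inside /= adj_sym uy !inE uS eqxx orbT.
move=> a c /setU1P[->|aS] /setU1P[->|cS].
- exact: connect0.
- exact: connect_trans yu1 (sub _ _ uS cS).
- exact: connect_trans (sub _ _ aS uS) uy1.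
- exact: sub.
Qed.

End Growth.

Section Tree.
Variables (R : realType) (H : hilbertType R).
Local Notation E := (ell2 H).
Local Notation J := (@emb R H).
Local Notation P := (@prj R H).

Lemma doubleS_inj : injective (fun m => m.*2.+1).
Proof. by move=> m k [/double_inj]. Qed.

Local Notation i0 := (push double_inj).
Local Notation i1 := (push doubleS_inj).
Local Notation p0 := (pull double_inj).
Local Notation p1 := (pull doubleS_inj).

Lemma even_odd_orth (x : E) : p0 (i1 x) = 0 /\ p1 (i0 x) = 0.
Proof.
split; apply: ell2P => m; rewrite pullE push0 // => k /(congr1 odd);
  by rewrite /= !odd_double.
Qed.

Lemma even_odd_sum (x : E) : i0 (p0 x) + i1 (p1 x) = x.
Proof.
apply: ell2P => m; rewrite ell2D.
have [k [->|->]] : exists k, m = k.*2 \/ m = k.*2.+1.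
  by exists m./2; have := odd_double_half m; case: (odd m); [right|left].
- rewrite (pushE double_inj) push0 ?addr0 // => l /(congr1 odd).
  by rewrite /= !odd_double.
- rewrite (pushE doubleS_inj) push0 ?add0r // => l /(congr1 odd).
  by rewrite /= !odd_double.
Qed.

(** The direct sum of two operators, on the even and the odd coordinates. *)
Definition osum (A B : {linear E -> E}) : {linear E -> E} := dsum i0 i1 p0 p1 A B.

Lemma p0_osum A B x : p0 ((osum A B) x) = A (p0 x).
Proof. by apply: p0_dsum => z; [exact: pushK|exact: (even_odd_orth z).1]. Qed.

Lemma p1_osum A B x : p1 ((osum A B) x) = B (p1 x).
Proof. by apply: p1_dsum => z; [exact: pushK|exact: (even_odd_orth z).2]. Qed.

Lemma even_odd_ext (x y : E) : p0 x = p0 y -> p1 x = p1 y -> x = y.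
Proof. by move=> h0 h1; rewrite -(even_odd_sum x) h0 h1 even_odd_sum. Qed.

Lemma qcomm_osum b (A B Q A' B' Q' : {linear E -> E}) :
  qcomm b A B Q -> qcomm b A' B' Q' -> qcomm b (osum A A') (osum B B') (osum Q Q').
Proof.
move=> h h' x; apply: even_odd_ext.
  by rewrite !p0_osum h; case: (b); rewrite !p0_osum.
by rewrite !p1_osum h'; case: (b); rewrite !p1_osum.
Qed.

Lemma qcomm_conj b (rho A B Q : {linear E -> E}) : (forall x, rho (rho x) = x) ->
  qcomm b A B Q -> qcomm b (rho \o A \o rho) (rho \o B \o rho) (rho \o Q \o rho).
Proof. by move=> rr h x /=; rewrite !rr h; case: b {h}; rewrite ?rr. Qed.

Variables (n : nat) (G : sgraph n) (b : bool).
Variables (T : 'I_n -> {linear H -> H}) (Q : oedge G -> {linear H -> H}).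

Definition lifted_on (S : {set 'I_n}) : Prop :=
  exists (V : 'I_n -> {linear E -> E}) (Qb : oedge G -> {linear E -> E}),
    (forall i, i \in S -> isom (V i) /\ lifts P (T i) (V i)) /\
    (forall p : oedge G, (val p).1 \in S -> (val p).2 \in S ->
       [/\ isom (Qb p), lifts P (Q p) (Qb p), isom (Q p) -> oplus_id (Q p) (Qb p) &
           qcomm b (V (val p).1) (V (val p).2) (Qb p)]).

Hypothesis cT : forall i, contractive (T i).
Hypothesis cQ : forall p, contractive (Q p).
Hypothesis TQ : forall p : oedge G, qcomm b (T (val p).1) (T (val p).2) (Q p).

Lemma lifted_on1 i : lifted_on [set i].
Proof.
have [_ [V [_ iV lV]]] := @slot_lift R H (T i) 1%N (cT i) isT.
exists (fun=> V), (fun=> idfun); split=> [j /set1P -> //|].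
move=> p /set1P ui /set1P vi; have /andP[uv _] := valP p.
by rewrite ui vi adj_irr in uv.
Qed.

Lemma edge_lift j y : G j y ->
  exists (p : oedge G) (Wj Wy Qb : {linear E -> E}),
    [/\ isom Wj /\ lifts P (T j) Wj, isom Wy /\ lifts P (T y) Wy,
        isom Qb /\ lifts P (Q p) Qb, isom (Q p) -> oplus_id (Q p) Qb &
        (val p = (j, y) /\ qcomm b Wj Wy Qb) \/ (val p = (y, j) /\ qcomm b Wy Wj Qb)].
Proof.
move=> jy; have [lt_jy|lt_yj|eq_jy] := ltngtP j y.
- have pP : G (j, y).1 (j, y).2 && ((j, y).1 < (j, y).2)%N by rewrite /= jy.
  pose p : oedge G := exist _ (j, y) pP.
  have [W1 [W2 [Qb [h1 h2 hQ hI hc]]]] := pair_lift (cT j) (cT y) (cQ p) (TQ p).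
  by exists p, W1, W2, Qb; split=> //; left.
- have pP : G (y, j).1 (y, j).2 && ((y, j).1 < (y, j).2)%N by rewrite /= adj_sym jy.
  pose p : oedge G := exist _ (y, j) pP.
  have [W1 [W2 [Qb [h1 h2 hQ hI hc]]]] := pair_lift (cT y) (cT j) (cQ p) (TQ p).
  by exists p, W2, W1, Qb; split=> //; right.
- by rewrite (val_inj eq_jy) adj_irr in jy.
Qed.

(** Here rho is the reflection of [amalgam] for the lift V j found so far and the
    lift Wj of the same operator in the pair for the new edge.  In terms of direct
    sums, the lift V j + Wj at j satisfies the old relations with the old lifts
    V i + Wj; it is fixed under conjugation by rho, and so satisfies the new
    relation with the conjugate of V j + Wy. *)
Lemma lifted_on_grow (S : {set 'I_n}) j y : j \in S -> y \notin S -> G j y ->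
  (forall u, u \in S -> G u y -> u = j) -> lifted_on S -> lifted_on (y |: S).
Proof.
move=> jS yS jy uniq [V [Qb [hV hQ]]].
have [iVj lVj] := hV j jS.
have [p [Wj [Wy [QA [[iWj lWj] [iWy lWy] [iQA lQA] oQA hc]]]]] := edge_lift jy.
have JP := @emb_prj R H.
have ip0 := @push_pull R H _ double_inj.
have ip1 := @push_pull R H _ doubleS_inj.
have p01 x := (even_odd_orth x).1.
have p10 x := (even_odd_orth x).2.
have i0J h : i0 (J h) = J h by apply: push_emb.
have p0J h : p0 (J h) = J h by rewrite -{1}i0J pushK.
have p1J h : p1 (J h) = 0 by rewrite -i0J p10.
have [rho [rr irho rJ Prho rV]] := @amalgam R E H J P JP i0 i1 p0 p1 ip0 ip1
  (pushK double_inj) (pushK doubleS_inj) p01 p10 even_odd_sum i0J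
  (T j) (V j) Wj iVj iWj lVj lWj.
have iD (A B : {linear E -> E}) : isom A -> isom B -> isom (osum A B).
  exact: (dsum_isom ip0 ip1 (pushK double_inj) (pushK doubleS_inj) p01 p10
    even_odd_sum).
have lD (U : {linear H -> H}) (A B : {linear E -> E}) :
    lifts P U A -> lifts P U (osum A B).
  exact: (@dsum_lifts R E H J P JP i0 i1 p0 p1 ip0 (pushK double_inj) p01 i0J).
have Prho' (x : E) : P (rho x) = P (p1 x) := Prho x.
have rJ' h : rho (J h) = i1 (J h) := rJ h.
pose id' : {linear E -> E} := idfun.
have iid : isom id' by [].
pose conj (A : {linear E -> E}) : {linear E -> E} := rho \o A \o rho.
have iconj (A : {linear E -> E}) : isom A -> isom (conj A) by move=> iA x z; rewrite /= irho iA irho.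
have lconj (U : {linear H -> H}) (A B : {linear E -> E}) : lifts P U B -> lifts P U (conj (osum A B)).
  move=> lB x; rewrite [LHS]Prho' p1_osum.
  have -> : P (B (p1 (rho x))) = U (P (p1 (rho x))) := lB _.
  by rewrite -Prho' rr.
pose V' i := if i == y then conj (osum (V j) Wy) else osum (V i) Wj.
pose Qb' (q : oedge G) := if ((val q).1 == y) || ((val q).2 == y)
  then conj (osum id' QA) else osum (Qb q) id'.
exists V', Qb'; split=> [i|q].
  rewrite /V' => /setU1P[->|iS].
    by rewrite eqxx; split; [apply/iconj/iD|apply: lconj].
  have -> : (i == y) = false by apply: contraNF yS => /eqP <-.
  by have [iV lV] := hV i iS; split; [apply: iD|apply: lD].
have nS v : v \in S -> (v == y) = false by move=> vS; apply: contraNF yS => /eqP <-.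
have V'j : osum (V j) Wj = conj (osum (V j) Wj) :> (E -> E).
  apply/funext => x; rewrite -[RHS]/(rho (osum (V j) Wj (rho x))).
  by rewrite -[osum _ _ (rho x)]rV rr.
have new_edge : q = p -> [/\ isom (conj (osum id' QA)), lifts P (Q q) (conj (osum id' QA)) &
    isom (Q q) -> oplus_id (Q q) (conj (osum id' QA))].
  move=> ->; split; [exact/iconj/iD|exact: lconj|].
  move=> /oQA QE x; have Pr : P (p1 (rho x)) = P x by rewrite -Prho' rr.
  pose w := Q p (P x) - P x.
  have -> : conj (osum id' QA) x = rho (rho x + i1 (J w)).
    congr (rho _); apply: even_odd_ext.
      by rewrite [LHS]p0_osum linearD /= p01 addr0.
    by rewrite [LHS]p1_osum linearD /= pushK QE Pr /w linearB /= addrCA.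
  by rewrite linearD /= rr -rJ' rr /w linearB /= addrCA.
have qc (A B : {linear E -> E}) : qcomm b A B QA ->
    qcomm b (conj (osum (V j) A)) (conj (osum (V j) B)) (conj (osum id' QA)).
  by move=> h; apply: qcomm_conj => //; apply: qcomm_osum => // x /=; case: (b).
have /andP[qG lt_q] := valP q.
move=> /setU1P[q1y|q1S] /setU1P[q2y|q2S].
- by rewrite q1y q2y adj_irr in qG.
- have q2j : (val q).2 = j by apply: uniq; rewrite // adj_sym -q1y.
  have valq : val q = (y, j) by rewrite [LHS]surjective_pairing q1y q2j.
  case: hc => [[valp _]|[valp hc]].
    have /andP[_] := valP p; rewrite valp => /= /ltnW.
    by rewrite leqNgt; move: lt_q; rewrite valq /= => ->.
  have [|h1 h2 h3] := new_edge; first by apply: val_inj; rewrite valp.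
  rewrite /V' /Qb' q1y q2j eqxx (nS j) //= V'j; split=> //; exact: qc.
- have q1j : (val q).1 = j by apply: uniq; rewrite // -q2y.
  have valq : val q = (j, y) by rewrite [LHS]surjective_pairing q1j q2y.
  case: hc => [[valp hc]|[valp _]]; last first.
    have /andP[_] := valP p; rewrite valp => /= /ltnW.
    by rewrite leqNgt; move: lt_q; rewrite valq /= => ->.
  have [|h1 h2 h3] := new_edge; first by apply: val_inj; rewrite valp.
  rewrite /V' /Qb' q1j q2y eqxx (nS j) //= V'j; split=> //; exact: qc.
- have [iq lq oq cq] := hQ q q1S q2S.
  rewrite /V' /Qb' !nS //=; split.
  + exact: iD.
  + exact: lD.
  + move=> /oq QE x; apply: even_odd_ext.
      by rewrite p0_osum QE prj_pull_fix // linearD linearB /= !p0J.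
    by rewrite p1_osum linearD linearB /= !p1J subr0 add0r.
  + by apply: qcomm_osum => // x /=; case: (b).
Qed.

Lemma tree_lift : connected_graph G -> acyclic G -> lifted_on [set: 'I_n]%SET.
Proof.
move=> [n0 conn] acyc.
suff grow k : (0 < k <= n)%N ->
    exists S : {set 'I_n}, [/\ #|S| = k, connected_in G S & lifted_on S].
  have [|S [cS _ lS]] := grow n; first by rewrite n0 leqnn.
  suff -> : [set: 'I_n]%SET = S by [].
  by apply/esym/eqP; rewrite eqEcard finset.subsetT cardsT card_ord cS /=.
elim: k => // -[_ _|k IH /= kn].
  exists [set Ordinal n0]%SET; split; [by rewrite cards1| |exact: lifted_on1].
  by move=> u v /set1P -> /set1P ->; apply/connectP; exists [::].
have [|S [cS conS lS]] := IH; first exact: ltnW kn.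
have [a aS] : exists a, a \in S by apply/set0Pn; rewrite -card_gt0 cS.
have [z zS] : exists z, z \notin S.
  have : (0 < #|finset.setC S|)%N by have := cardsC S; rewrite card_ord cS; lia.
  by rewrite card_gt0 => /set0Pn[z]; rewrite inE; exists z.
have [u [y [uS yS uy]]] := crossing_edge (conn a z) aS zS.
exists (y |: S)%SET; split.
- by rewrite cardsU1 yS cS.
- exact: connected_in_grow uS uy.
- apply: (lifted_on_grow uS yS uy) => // v vS vy.
  exact: (unique_neighbour acyc conS yS vS uS vy uy).
Qed.

End Tree.

(** * Passing to bounded operators *)

Section BoundedOperators.
Variables (R : realType) (H : hilbertType R).

Lemma contraction_sqn (A : bounded_op H) : op_contraction A -> contractive A.
Proof.
move=> cA x; have [x0|x0] := eqVneq (sqn x) 0.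
  by rewrite (sqn_eq0 x0) linear0 sqn0.
have xp : 0 < sqn x by rewrite lt_def x0 sqn_ge0.
pose t := (Num.sqrt (sqn x))^-1.
have t2 : t ^+ 2 * sqn x = 1 by rewrite exprVn sqr_sqrtr ?ltW // mulVf.
have y1 : `|t%:C%C *: x| <= 1.
  by rewrite norm_sqn sqnZ t2 sqrtr1.
have : ((complex.Re `|A (t%:C%C *: x)|)%:E <= opnorm A)%E.
  by apply: ereal_sup_ubound; exists (t%:C%C *: x).
move/le_trans => /(_ _ cA); rewrite lee_fin norm_sqn /= linearZ sqnZ /=.
rewrite -[X in _ <= X]sqrtr1 ler_sqrt // -t2 ler_pM2l //.
by rewrite exprn_gt0 // invr_gt0 sqrtr_gt0.
Qed.

Lemma op_adjointE (A : bounded_op H) (y z : H) :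
  (forall x : H, inner (A x) y = inner x z) -> op_adjoint A y = z.
Proof.
move=> h; have : [set z | forall x : H, inner (A x) y = inner x z] (op_adjoint A y).
  by apply: xgetI h.
by move=> h'; apply: inner_inj => x; rewrite -h -h'.
Qed.

Lemma op_adjointP (A : bounded_op H) (x y : H) : op_contraction A ->
  inner (A x) y = inner x (op_adjoint A y).
Proof.
move=> cA; have [|A' A'P] := @adjoint_exists _ _ _ (op_linear A).
  by exists 1 => z; rewrite mul1r contraction_sqn.
by rewrite (op_adjointE (fun x => A'P x y)).
Qed.

Lemma unitary_isom (A : bounded_op H) : op_contraction A -> op_unitary A -> isom A.
Proof. by move=> cA [uA _] x y; rewrite op_adjointP // [op_adjoint A _]uA. Qed.

Lemma isom_norm (V : {linear H -> H}) : isom V -> forall x, `|V x| = `|x|.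
Proof. by move=> iV x; rewrite !norm_sqn /sqnorm_of iV. Qed.

Lemma bounded_op_of_isom (V : {linear H -> H}) : isom V -> exists B : bounded_op H, op_linear B = V.
Proof.
move=> iV; have h : exists M : R[i], forall x : H, `|V x| <= M * `|x|.
  by exists 1 => x; rewrite mul1r isom_norm.
by exists (BoundedOp h).
Qed.

End BoundedOperators.

Lemma isometric_lift_intro (R : realType) (H : hilbertType R)
    (A : bounded_op H) (B : bounded_op (ell2 H)) :
  op_contraction A -> isom B -> lifts (@prj R H) A B -> op_isometric_lift (@emb R H) A B.
Proof.
move=> cA iB lB; split=> [h|x]; last exact: isom_norm.
apply: op_adjointE => x; rewrite prj_emb.
have -> : prj (B x) = A (prj x) := lB x.
by rewrite op_adjointP // -prj_emb.
Qed.

Lemma commuting_isometric_lifts (b : bool) (R : realType) (H : hilbertType R) (n : nat) (G : sgraph n)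
    (Q : oedge G -> bounded_op H) (T : 'I_n -> bounded_op H) :
  connected_graph G -> acyclic G ->
  (forall p, op_contraction (Q p)) -> (forall i, op_contraction (T i)) ->
  (forall p : oedge G, qcomm b (T (val p).1) (T (val p).2) (Q p)) ->
  exists (K : hilbertType R) (J : {linear H -> K})
           (Qbar : oedge G -> bounded_op K) (V : 'I_n -> bounded_op K),
      [/\ hilbert_embedding J,
          forall p : oedge G, op_isometric_lift J (Q p) (Qbar p),
          forall i : 'I_n, op_isometric_lift J (T i) (V i),
          forall p : oedge G, qcomm b (V (val p).1) (V (val p).2) (Qbar p) &
          forall p : oedge G, op_unitary (Q p) -> dsum_id J (Q p) (Qbar p)].
Proof.
move=> conn acyc cQ cT TQ.
have [V [Qb [hV hQ]]] := @tree_lift R H n G b (fun i => op_linear (T i))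
  (fun p => op_linear (Q p)) (fun i => contraction_sqn (cT i))
  (fun p => contraction_sqn (cQ p)) TQ conn acyc.
have {}hV i := hV i (finset.in_setT i).
have {}hQ p := hQ p (finset.in_setT _) (finset.in_setT _).
have /choice[W WE] : forall i, exists B : bounded_op (ell2 H), op_linear B = V i.
  by move=> i; apply: bounded_op_of_isom; case: (hV i).
have /choice[Qbar QE] : forall p, exists B : bounded_op (ell2 H), op_linear B = Qb p.
  by move=> p; apply: bounded_op_of_isom; case: (hQ p).
exists (ell2 H), (@emb R H), Qbar, W; split.
- exact: emb_inner.
- move=> p; have [iq lq _ _] := hQ p.
  by apply: isometric_lift_intro => //; rewrite QE.
- move=> i; have [iv lv] := hV i.
  by apply: isometric_lift_intro => //; rewrite WE.
- by move=> p; rewrite !WE QE; have [] := hQ p.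
- move=> p uQ; have [_ _ oq _] := hQ p.
  have {}oq := oq (unitary_isom (cQ p) uQ).
  split=> [h|k kJ]; rewrite QE oq.
    by rewrite embK subrr addr0.
  have -> : prj k = 0.
    by apply: inner_inj => h; rewrite inner0r -emb_prj innerC kJ rmorph0.
  by rewrite !linear0 add0r addr0.
Qed.

Theorem theorem8p7 (R : realType) (H : hilbertType R) (n : nat) (G : sgraph n)
    (hconn : connected_graph G) (hacyc : acyclic G)
    (Q : oedge G -> bounded_op H) (hQ : forall p : oedge G, op_contraction (Q p))
    (T : 'I_n -> bounded_op H) (hT : forall i : 'I_n, op_contraction (T i)) :
  (GQL_commuting Q T ->
    exists (K : hilbertType R) (J : {linear H -> K})
           (Qbar : oedge G -> bounded_op K) (V : 'I_n -> bounded_op K),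
      [/\ hilbert_embedding J,
          forall p : oedge G, op_isometric_lift J (Q p) (Qbar p),
          forall i : 'I_n, op_isometric_lift J (T i) (V i),
          GQL_commuting Qbar V &
          forall p : oedge G, op_unitary (Q p) -> dsum_id J (Q p) (Qbar p)]) /\
  (GQM_commuting Q T ->
    exists (K : hilbertType R) (J : {linear H -> K})
           (Qbar : oedge G -> bounded_op K) (V : 'I_n -> bounded_op K),
      [/\ hilbert_embedding J,
          forall p : oedge G, op_isometric_lift J (Q p) (Qbar p),
          forall i : 'I_n, op_isometric_lift J (T i) (V i),
          GQM_commuting Qbar V &
          forall p : oedge G, op_unitary (Q p) -> dsum_id J (Q p) (Qbar p)]).
Proof.
split=> TQ.
- have [K [J [Qbar [V [hJ hQbar hV VQ hU]]]]] :=
    @commuting_isometric_lifts true R H n G Q T hconn hacyc hQ hT TQ.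
  by exists K, J, Qbar, V.
- have [K [J [Qbar [V [hJ hQbar hV VQ hU]]]]] :=
    @commuting_isometric_lifts false R H n G Q T hconn hacyc hQ hT TQ.
  by exists K, J, Qbar, V.
Qed.
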